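(* There is a polynomial-time algorithm with access to an oracle solving OLCPM which solves UPM in the following sense. On an input instance of UPM for a matroid $\mathcal M$, the algorithm runs in time polynomial in the size of the instance and makes a polynomial number of oracle calls. Each oracle call is an instance of OLCPM of size polynomial in the size of the input UPM instance, on some matroid $\mathcal M'$ obtained from $\mathcal M$ by introducing parallel copies for some of the elements of $\mathcal M$. The algorithm outputs the exact answer to the input UPM instance.
   Context: **Sequential principal-agent model.** Let $\mathcal M=(E,\mathcal I)$ be a matroid with ground set $E$, $|E|=n$, accessed through an independence oracle. Each element $i\in E$ has a probing cost $c_i\ge 0$ and an outcome value $X_i\ge 0$. The random variables $X_i$, $i\in E$, are independent, and $X_i\sim\mathcal F_i$ has at most $m$ outcomes: $\Pr[X_i=v_{i,k}]=p_{i,k}$ for $k=1,\dots,m$. The values $v_{i,k}\ge 0$, probabilities $p_{i,k}$ and costs $c_i$ are given explicitly as rational numbers and are known to both parties. A linear contract $t_\alpha$, $\alpha\in[0,1]$, pays the agent $\alpha X$ when the principal's reward is $X$. Given $t_\alpha$, the agent follows a (possibly randomized) adaptive strategy $\pi$. At each time, depending on the elements probed so far and their observed values, the agent either probes a further element $i$ (paying $c_i$ and observing $X_i$) or halts. On halting with probed set $S(\pi)$, the agent returns an independent set $I(\pi)\in\mathcal I$ with $I(\pi)\subseteq S(\pi)$. The principal's reward is $\sum_{i\in I(\pi)}X_i$. The expected utilities are $$U_A(t_\alpha,\pi)=\mathbb E\Big[\alpha\sum_{i\in I(\pi)}X_i-\sum_{i\in S(\pi)}c_i\Big],\qquad U_P(t_\alpha,\pi)=\mathbb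 E\Big[(1-\alpha)\sum_{i\in I(\pi)}X_i\Big].$$ The agent's best response is a strategy maximizing $U_P(t_\alpha,\pi)$ among all strategies in $\arg\max_\pi U_A(t_\alpha,\pi)$. $U_P(t_\alpha)$ denotes the principal's utility under a best response. **OLCPM (Optimal Linear Contract Problem on Matroids).** Given a matroid $\mathcal M=(E,\mathcal I)$ (through an independence oracle) and, for every $i\in E$, a cost $c_i\ge 0$ and a distribution $\mathcal F_i$ of the independent outcome value $X_i$ (an explicit list of values $v_{i,k}\ge 0$ and probabilities $p_{i,k}$, $k=1,\dots,m$), find a linear contract (i.e. $\alpha\in[0,1]$) maximizing $U_P(t_\alpha)$. **UPM (Unreliability Problem on Matroids).** Given a matroid $\mathcal M=(E,\mathcal I)$, an element $e\in E$, and for every $i\in E\setminus\{e\}$ a rational probability $p_i\in[0,1]$, let $T\subseteq E\setminus\{e\}$ be the random set containing each $i$ independently with probability $p_i$. Determine $\Pr[\operatorname{rank}_{\mathcal M}(T)+1=\operatorname{rank}_{\mathcal M}(T\cup\{e\})]$, i.e. the probability that $e$ is not spanned by $T$. The size of an instance is measured by $|E|$ (and $m$ for OLCPM) plus the length of the binary encoding of all numbers in it. *)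

(* Defs.v *)
From HB Require Import structures.
From mathcomp Require Import all_boot all_order all_algebra.
From mathcomp Require Import reals.
From Stdlib Require List.

Set Implicit Arguments.
Unset Strict Implicit.
Unset Printing Implicit Defensive.

Import Order.TTheory GRing.Theory Num.Theory.
Local Open Scope ring_scope.

Record matroid (E : finType) := Matroid {
  indep : {set {set E}};
  indep_set0 : set0 \in indep;
  indep_sub : forall A B : {set E}, A \subset B -> B \in indep -> A \in indep;
  indep_aug : forall A B : {set E}, A \in indep -> B \in indep ->
    (#|A| < #|B|)%N -> exists2 x, x \in B :\: A & x |: A \in indep
}.

Definition rank (E : finType) (M : matroid E) (T : {set E}) : nat :=
  \max_(J in indep M | J \subset T) #|J|.

(* [f j] is the element of which [j] is a copy: a set is independent when it
   contains at most one copy of each element and the originals form an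
   independent set. *)
Section Parallel.
Variables (E E' : finType) (M : matroid E) (f : E' -> E).

Definition parallel_indep : {set {set E'}} :=
  [set A : {set E'} | (#|f @: A| == #|A|) && (f @: A \in indep M)].

Lemma parallel_set0 : set0 \in parallel_indep.
Proof. by rewrite inE imset0 !cards0 eqxx indep_set0. Qed.

Lemma parallel_sub (A B : {set E'}) :
  A \subset B -> B \in parallel_indep -> A \in parallel_indep.
Proof.
move=> sAB; rewrite !inE => /andP[/imset_injP injB indB].
rewrite (indep_sub (imsetS f sAB) indB) andbT; apply/imset_injP.
by move=> x y xA yA; apply: injB; apply: (subsetP sAB).
Qed.

Lemma parallel_aug (A B : {set E'}) :
  A \in parallel_indep -> B \in parallel_indep -> (#|A| < #|B|)%N ->
  exists2 x, x \in B :\: A & x |: A \in parallel_indep.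
Proof.
rewrite !inE => /andP[/eqP cA iA] /andP[/eqP cB iB] ltAB.
have [|_ /setDP[/imsetP[b bB ->] nfA] ind] := indep_aug iA iB.
  by rewrite cA cB.
have nbA : b \notin A by apply: contra nfA => bA; apply: imset_f.
exists b; first by rewrite inE nbA.
by rewrite inE imsetU1 ind andbT !cardsU1 nfA nbA cA.
Qed.

Definition parallel : matroid E' :=
  Matroid parallel_set0 parallel_sub parallel_aug.
End Parallel.

(* Every element keeps at least one copy (itself). *)
Definition is_parallel_extension (E E' : finType)
    (M : matroid E) (M' : matroid E') : Prop :=
  exists f : {ffun E' -> E}, (forall i, exists j, f j = i) /\ M' = parallel M f.

Record olcpm := Olcpm {
  oN : nat;
  om : nat;
  omat : matroid 'I_oN;
  ocost : {ffun 'I_oN -> rat};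
  oval : 'M[rat]_(oN, om);
  oprob : 'M[rat]_(oN, om)
}.

Definition olcpm_valid (I : olcpm) : Prop :=
  [/\ forall i, 0 <= ocost I i,
      forall i k, 0 <= oval I i k,
      forall i k, 0 <= oprob I i k
    & forall i, \sum_k oprob I i k = 1].

(* Randomized adaptive strategies as decision trees: halt and return a set;
   probe an element and continue according to the value observed; or draw the
   continuation at random, with probabilities [w]. *)
Inductive strategy (R : Type) (E : finType) : Type :=
| Halt of {set E}
| Probe of E & (rat -> strategy R E)
| Mixed (k : nat) (w : 'I_k -> R) (u : 'I_k -> strategy R E).

Section Model.
Variables (R : realType) (I : olcpm).
Local Notation E := 'I_(oN I).

(* [S] is the set of elements probed so far. *)
Fixpoint feasible_from (S : {set E}) (t : strategy R E) : Prop :=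
  match t with
  | Halt J => J \subset S /\ J \in indep (omat I)
  | Probe i next =>
      i \notin S /\ forall k, feasible_from (i |: S) (next (oval I i k))
  | Mixed k w u =>
      [/\ forall j, 0 <= w j, \sum_(j < k) w j = 1
        & forall j, feasible_from S (u j)]
  end.

Definition feasible (t : strategy R E) : Prop := feasible_from set0 t.

(* Expectation, over the internal randomness of the strategy only, of
   [pay J S], where [J] is the returned set and [S] the final probed set, when
   the outcome values are [X]. *)
Fixpoint expect (X : E -> rat) (pay : {set E} -> {set E} -> R)
    (S : {set E}) (t : strategy R E) : R :=
  match t with
  | Halt J => pay J S
  | Probe i next => expect X pay (i |: S) (next (X i))
  | Mixed k w u => \sum_(j < k) w j * expect X pay S (u j)
  end.

Definition profile := {ffun E -> 'I_(om I)}.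

Definition profile_prob (x : profile) : rat := \prod_i oprob I i (x i).

Definition profile_val (x : profile) (i : E) : rat := oval I i (x i).

Definition agent_utility (alpha : R) (t : strategy R E) : R :=
  \sum_(x : profile) ratr (profile_prob x) *
    expect (profile_val x)
      (fun J S => alpha * (\sum_(i in J) ratr (profile_val x i))
                  - \sum_(i in S) ratr (ocost I i))
      set0 t.

Definition principal_utility (alpha : R) (t : strategy R E) : R :=
  \sum_(x : profile) ratr (profile_prob x) *
    expect (profile_val x)
      (fun J _ => (1 - alpha) * \sum_(i in J) ratr (profile_val x i))
      set0 t.

Definition agent_optimal (alpha : R) (t : strategy R E) : Prop :=
  feasible t /\
  forall t', feasible t' -> agent_utility alpha t' <= agent_utility alpha t.

Definition best_response (alpha : R) (t : strategy R E) : Prop :=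
  agent_optimal alpha t /\
  forall t', agent_optimal alpha t' ->
    principal_utility alpha t' <= principal_utility alpha t.

(* [u] is the principal's utility U_P(t_alpha) under a best response. *)
Definition principal_value (alpha u : R) : Prop :=
  exists2 t, best_response alpha t & u = principal_utility alpha t.

Definition optimal_contract (alpha : R) : Prop :=
  0 <= alpha <= 1 /\
  exists2 u, principal_value alpha u &
    forall alpha' u', 0 <= alpha' <= 1 -> principal_value alpha' u' -> u' <= u.
End Model.

Definition solves_olcpm (R : realType) (O : olcpm -> rat) : Prop :=
  forall I, olcpm_valid I -> optimal_contract I (ratr (O I) : R).

(* The entry [uprob U (uelt U)] is not part of the instance: it is ignored by
   every definition below. *)
Record upm := Upm {
  un : nat;
  umat : matroid 'I_un;
  uelt : 'I_un;
  uprob : {ffun 'I_un -> rat}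
}.

Definition upm_valid (U : upm) : Prop :=
  forall i, i != uelt U -> 0 <= uprob U i <= 1.

Definition upm_answer (U : upm) : rat :=
  \sum_(T : {set 'I_(un U)} |
        (T \subset [set~ uelt U]) &&
        ((rank (umat U) T).+1 == rank (umat U) (uelt U |: T)))
    (\prod_(i in T) uprob U i) *
    \prod_(i in [set~ uelt U] :\: T) (1 - uprob U i).

(* One sign bit and the binary digits (one digit for 0). *)
Definition int_size (z : int) : nat := (trunc_log 2 `|z|%N).+2.

Definition rat_size (q : rat) : nat := (int_size (numq q) + int_size (denq q))%N.

Definition upm_size (U : upm) : nat :=
  (un U + \sum_(i | i != uelt U) rat_size (uprob U i))%N.

Definition olcpm_size (I : olcpm) : nat :=
  (oN I + om I + \sum_i rat_size (ocost I i)
   + \sum_i \sum_k (rat_size (oval I i k) + rat_size (oprob I i k)))%N.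

(* A while language over binary trees of rationals with logarithmic (bit) cost:
   each operation is charged the bit size of all the values it reads and
   produces. The operations are computable in time polynomial in this charge,
   so polynomial time here is polynomial time on Turing machines. *)
Inductive data := Atom of rat | Pair of data & data.

Fixpoint data_size (d : data) : nat :=
  match d with
  | Atom q => rat_size q
  | Pair a b => (data_size a + data_size b).+1
  end.

Definition data_list (s : seq data) : data := foldr Pair (Atom 0) s.

Inductive expr :=
| EVar of nat
| EConst of rat
| ECons of expr & expr
| EFst of expr
| ESnd of expr
| EIsPair of expr
| EAdd of expr & expr
| ESub of expr & expr
| EMul of expr & expr
| EDiv of expr & expr
| ELeq of expr & expr.

Definition store := nat -> data.

Definition upd (s : store) (x : nat) (d : data) : store :=
  fun y => if y == x then d else s y.

Definition num_op (op : rat -> rat -> rat) (a b : data) : data :=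
  match a, b with
  | Atom p, Atom q => Atom (op p q)
  | _, _ => Atom 0
  end.

Fixpoint eval (s : store) (e : expr) : data :=
  match e with
  | EVar x => s x
  | EConst q => Atom q
  | ECons a b => Pair (eval s a) (eval s b)
  | EFst a => if eval s a is Pair d _ then d else Atom 0
  | ESnd a => if eval s a is Pair _ d then d else Atom 0
  | EIsPair a => if eval s a is Pair _ _ then Atom 1 else Atom 0
  | EAdd a b => num_op (fun p q => p + q) (eval s a) (eval s b)
  | ESub a b => num_op (fun p q => p - q) (eval s a) (eval s b)
  | EMul a b => num_op (fun p q => p * q) (eval s a) (eval s b)
  | EDiv a b => num_op (fun p q => p / q) (eval s a) (eval s b)
  | ELeq a b => num_op (fun p q => (p <= q)%R%:R) (eval s a) (eval s b)
  end.

Fixpoint expr_cost (s : store) (e : expr) : nat :=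
  (data_size (eval s e) +
   match e with
   | EVar _ | EConst _ => 0
   | EFst a | ESnd a | EIsPair a => expr_cost s a
   | ECons a b | EAdd a b | ESub a b | EMul a b | EDiv a b | ELeq a b =>
       expr_cost s a + expr_cost s b
   end)%N.

Definition truth (d : data) : bool := if d is Atom q then q != 0 else true.

Inductive com :=
| CAssign of nat & expr
| CSeq of com & com
| CIf of expr & com & com
| CWhile of expr & com
| CAskIndep of nat & expr
| CAskOlcpm of nat & expr.

Definition enc_elt (n : nat) (i : 'I_n) : data := Atom (i : nat)%:R.

Definition enc_elts (n : nat) (s : seq 'I_n) : data :=
  data_list [seq enc_elt i | i <- s].

(* The number of outcomes, then, for each element of the parallel extension,
   the element it copies, its cost and its list of (value, probability). The
   list of copied elements determines the matroid: a query to its independence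
   oracle amounts to one query to the oracle of the original matroid. *)
Definition enc_query (n N m : nat) (f : {ffun 'I_N -> 'I_n})
    (c : {ffun 'I_N -> rat}) (v p : 'M[rat]_(N, m)) : data :=
  Pair (Atom m%:R)
    (data_list [seq Pair (enc_elt (f j)) (Pair (Atom (c j))
       (data_list [seq Pair (Atom (v j k)) (Atom (p j k)) | k <- enum 'I_m]))
     | j <- enum 'I_N]).

(* [exec M O c s s' t q]: started in store [s], the program [c] halts in store
   [s'] after time [t], having submitted to the oracle [O] the list of instances
   [q]. The matroid [M] is accessible only through the two kinds of queries. An
   execution is stuck on a query that does not encode an instance. The relation
   is deterministic, as the encodings are injective. As usual for oracle
   machines, the answer is written for free and paid for when it is read. *)
Inductive exec (n : nat) (M : matroid 'I_n) (O : olcpm -> rat) :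
    com -> store -> store -> nat -> seq olcpm -> Prop :=
| ExecAssign x e s :
    exec M O (CAssign x e) s (upd s x (eval s e)) (expr_cost s e).+1 [::]
| ExecSeq c1 c2 s1 s2 s3 t1 t2 q1 q2 :
    exec M O c1 s1 s2 t1 q1 -> exec M O c2 s2 s3 t2 q2 ->
    exec M O (CSeq c1 c2) s1 s3 (t1 + t2).+1 (q1 ++ q2)
| ExecIf e c1 c2 s s' t q :
    exec M O (if truth (eval s e) then c1 else c2) s s' t q ->
    exec M O (CIf e c1 c2) s s' (expr_cost s e + t).+1 q
| ExecWhileStop e c s :
    ~~ truth (eval s e) ->
    exec M O (CWhile e c) s s (expr_cost s e).+1 [::]
| ExecWhileLoop e c s1 s2 s3 t1 t2 q1 q2 :
    truth (eval s1 e) ->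
    exec M O c s1 s2 t1 q1 -> exec M O (CWhile e c) s2 s3 t2 q2 ->
    exec M O (CWhile e c) s1 s3 (expr_cost s1 e + t1 + t2).+1 (q1 ++ q2)
| ExecAskIndep x e s (l : seq 'I_n) :
    eval s e = enc_elts l ->
    exec M O (CAskIndep x e) s
      (upd s x (Atom ([set i in l] \in indep M)%:R)) (expr_cost s e).+1 [::]
| ExecAskOlcpm x e s N m (f : {ffun 'I_N -> 'I_n})
    (c : {ffun 'I_N -> rat}) (v p : 'M[rat]_(N, m)) :
    eval s e = enc_query f c v p ->
    exec M O (CAskOlcpm x e) s
      (upd s x (Atom (O (Olcpm (parallel M f) c v p)))) (expr_cost s e).+1
      [:: Olcpm (parallel M f) c v p].

(* The distinguished element, then the list of probabilities, with 0 in place of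
   the missing probability of the distinguished element. The matroid is not part
   of the input string. *)
Definition enc_upm (U : upm) : data :=
  Pair (enc_elt (uelt U))
    (data_list [seq Atom (if i == uelt U then 0 else uprob U i)
               | i <- enum 'I_(un U)]).

(* The input is in register 0, where the output is expected too. *)
Definition init_store (d : data) : store := upd (fun=> Atom 0) 0 d.

(* Main.v *)
(* Process the elements in order, and let [T_k] be the random set [T] restricted
   to the first [k] of them. The expected rank [R_k] of [T_k] satisfies
   [R_{k+1} = R_k + p_k q_k], where [q_k] is the probability that element [k] is
   not spanned by [T_k]; so it is enough to determine the probability [q] that a
   target [a] is not spanned by a random set [T] whose expected rank [R] is known.

   Offer copies of the elements with cost 0 and value 1 with probability [p_i]
   (0 otherwise), together with a copy of [a] with cost [c] and value 1. The agent
   probes the costly copy only if [alpha >= c], and then exactly when it is not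
   spanned by the elements of value 1. Hence the principal earns at most [R],
   reached at [alpha = 0], when [alpha < c], and at most [(1 - c) (R + q)], reached
   at [alpha = c], otherwise. If [R > 0], the only candidates for the optimal
   contract are [0] and [c], and the answer compares [(1 - c) (R + q)] to [R],
   that is, for [c = theta / (R + theta)], [q] to [theta]. As [q] is an integer
   multiple of the product [delta] of the inverses of the denominators of the
   [p_i], a binary search with thresholds halfway between these multiples finds it
   exactly. If [R = 0], then [q] is 1 or 0 according to whether [a] is independent.

   The language gives no access to denominators; [delta / b] is obtained from
   [delta] and a fraction [a / b] as the gcd of [delta] and [delta a / b]. *)
Require Import Defs.
From mathcomp Require Import all_boot all_order all_algebra.
From mathcomp Require Import reals.
From mathcomp Require Import zify ring lra.
From Stdlib Require List.

Set Implicit Arguments.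
Unset Strict Implicit.
Unset Printing Implicit Defensive.

Import Order.TTheory GRing.Theory Num.Theory.
Local Open Scope ring_scope.

(** * Bit sizes *)

Lemma int_size_le (z : int) (k : nat) :
  (`|z| < 2 ^ k.+1)%N -> (int_size z <= k.+2)%N.
Proof.
move=> zk; rewrite /int_size !ltnS.
have [-> | z0] := posnP `|z|%N; first by rewrite trunc_log0.
rewrite -ltnS -(@ltn_exp2l 2) //.
exact: leq_ltn_trans (trunc_logP _ _) zk.
Qed.

Lemma int_size_spec (z : int) : (`|z| < 2 ^ (int_size z).-1)%N.
Proof. by rewrite /int_size /=; apply: trunc_log_ltn. Qed.

(** By Gauss's lemma the reduced numerator and denominator of [q] divide [a] and [d]. So any
    fraction representing [q], reduced or not, bounds its size. *)
Lemma rat_size_frac (q : rat) (a d : int) (k l : nat) :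
  q * d%:~R = a%:~R -> d != 0 -> (`|a| < 2 ^ k.+1)%N -> (`|d| < 2 ^ l.+1)%N ->
  (rat_size q <= k + l + 4)%N.
Proof.
move=> qd d0 ak dl.
have e : numq q * d = a * denq q.
  by apply/eqP; rewrite -(eqr_int rat) !rmorphM /= -qd numqE; apply/eqP; ring.
have en : (`|numq q| * `|d| = `|a| * `|denq q|)%N by rewrite -!abszM e.
have cop := coprime_num_den q.
have dd : (`|denq q| %| `|d|)%N.
  by rewrite -(@Gauss_dvdr _ `|numq q|) 1?coprime_sym // en dvdn_mull.
have dn : (`|numq q| %| `|a|)%N.
  by rewrite -(@Gauss_dvdl _ _ `|denq q|) // -en dvdn_mulr.
have ld : (`|denq q| <= `|d|)%N by apply: dvdn_leq => //; rewrite absz_gt0.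
have la : (`|numq q| <= `|a|)%N.
  (* Divisibility gives no bound when [a] is 0; the numerator is then 0 as well. *)
  have [a0|] := posnP `|a|%N; last by move=> ?; apply: dvdn_leq.
  move: en; rewrite a0 mul0n => /eqP; rewrite muln_eq0 => /orP[/eqP -> //|].
  by rewrite absz_eq0 (negPf d0).
rewrite /rat_size.
have := int_size_le (leq_ltn_trans la ak).
by have := int_size_le (leq_ltn_trans ld dl); lia.
Qed.

Lemma rat_size_ge4 (q : rat) : (4 <= rat_size q)%N.
Proof. by rewrite /rat_size /int_size; lia. Qed.

Lemma data_size_ge4 (d : data) : (4 <= data_size d)%N.
Proof. by elim: d => [q|a ha b hb] /=; [exact: rat_size_ge4 | lia]. Qed.

Lemma rat_size_bool (b : bool) : (rat_size b%:R <= 6)%N.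
Proof.
apply: (@rat_size_frac _ (b : nat)%:Z 1 1 1) => //; first by rewrite mulr1.
by case: b.
Qed.

Lemma rat_size0 : rat_size 0 = 4%N.
Proof. by rewrite /rat_size /int_size /= trunc_log0 trunc_log1. Qed.

Lemma rat_sizeP (q : rat) : exists k l : nat,
  [/\ (`|numq q| < 2 ^ k.+1)%N, (`|denq q| < 2 ^ l.+1)%N
    & rat_size q = (k + l + 4)%N].
Proof.
exists (trunc_log 2 `|numq q|), (trunc_log 2 `|denq q|).
by split; rewrite ?trunc_log_ltn // /rat_size /int_size; lia.
Qed.

(** The two denominators enter both the numerator and the denominator of the sum, whence the factor
    2, which also absorbs the additive constants. *)
Lemma rat_sizeD (p q : rat) :
  (rat_size (p + q) <= 2 * (rat_size p + rat_size q))%N.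
Proof.
have [a [b [pa pb ->]]] := rat_sizeP p.
have [c [d [qc qd ->]]] := rat_sizeP q.
apply: leq_trans (_ : (a + b + c + d + 2) + (b + d + 1) + 4 <= _)%N; last by lia.
apply: (@rat_size_frac _ (numq p * denq q + numq q * denq p) (denq p * denq q)).
- rewrite rmorphD !rmorphM /= !numqE; ring.
- by rewrite mulf_neq0 // denq_neq0.
- have h1 : (`|numq p| * `|denq q| < 2 ^ a.+1 * 2 ^ d.+1)%N by apply: ltn_mul.
  have h2 : (`|numq q| * `|denq p| < 2 ^ c.+1 * 2 ^ b.+1)%N by apply: ltn_mul.
  have e1 : (2 ^ a.+1 * 2 ^ d.+1 <= 2 ^ (a + b + c + d + 2))%N.
    by rewrite -expnD leq_exp2l //; lia.
  have e2 : (2 ^ c.+1 * 2 ^ b.+1 <= 2 ^ (a + b + c + d + 2))%N.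
    by rewrite -expnD leq_exp2l //; lia.
  have := leq_trans h1 e1; have := leq_trans h2 e2.
  rewrite -!abszM expnS; lia.
- rewrite abszM; apply: leq_trans (ltn_mul pb qd) _.
  by rewrite -expnD leq_exp2l //; lia.
Qed.

Lemma rat_sizeN (q : rat) : rat_size (- q) = rat_size q.
Proof. by rewrite /rat_size numqN denqN /int_size abszN. Qed.

Lemma rat_sizeB (p q : rat) :
  (rat_size (p - q) <= 2 * (rat_size p + rat_size q))%N.
Proof. by have := rat_sizeD p (- q); rewrite rat_sizeN. Qed.

Lemma rat_sizeM (p q : rat) :
  (rat_size (p * q) <= 2 * (rat_size p + rat_size q))%N.
Proof.
have [a [b [pa pb ->]]] := rat_sizeP p.
have [c [d [qc qd ->]]] := rat_sizeP q.
apply: leq_trans (_ : (a + c + 1) + (b + d + 1) + 4 <= _)%N; last by lia.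
apply: (@rat_size_frac _ (numq p * numq q) (denq p * denq q)).
- rewrite !rmorphM /= !numqE; ring.
- by rewrite mulf_neq0 // denq_neq0.
- rewrite abszM; apply: leq_trans (ltn_mul pa qc) _.
  by rewrite -expnD leq_exp2l //; lia.
- rewrite abszM; apply: leq_trans (ltn_mul pb qd) _.
  by rewrite -expnD leq_exp2l //; lia.
Qed.

Lemma rat_sizeV (q : rat) : (rat_size q^-1 <= rat_size q)%N.
Proof.
have [->|q0] := eqVneq q 0; first by rewrite invr0.
have [a [b [qa qb ->]]] := rat_sizeP q.
rewrite [X in (X + 4)%N]addnC.
apply: (@rat_size_frac _ (denq q) (numq q)) => //; last by rewrite numq_eq0.
by rewrite numqE mulKf.
Qed.

Lemma rat_size_div (p q : rat) :
  (rat_size (p / q) <= 2 * (rat_size p + rat_size q))%N.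
Proof.
by apply: leq_trans (rat_sizeM _ _) _; have := rat_sizeV q; lia.
Qed.

(** * Cost of programs *)

(* With all registers of size at most [B], evaluating [e] costs at most
   [expr_factor e * B.+1]. *)
Fixpoint expr_factor (e : expr) : nat :=
  match e with
  | EVar _ => 1
  | EConst q => rat_size q
  | EFst a | ESnd a | EIsPair a => 2 * expr_factor a + 6
  | ECons a b | EAdd a b | ESub a b | EMul a b | EDiv a b | ELeq a b =>
      3 * (expr_factor a + expr_factor b) + 6
  end.

Definition bounded (B : nat) (s : store) := forall x, (data_size (s x) <= B)%N.

Lemma num_op_size (op : rat -> rat -> rat) (a b : data) :
  (forall p q, (rat_size (op p q) <= 2 * (rat_size p + rat_size q))%N) ->
  (data_size (num_op op a b) <= 2 * (data_size a + data_size b))%N.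
Proof.
move=> h; case: a b => [p|a1 a2] [q|b1 b2] /=; rewrite ?rat_size0 //; try exact: h.
all: try have := rat_size_ge4 p; try have := rat_size_ge4 q.
all: try have := data_size_ge4 a1; try have := data_size_ge4 b1; lia.
Qed.

(** Both bounds are proved together because the cost of a node includes the size of its value. An
    arithmetic node at most doubles the total size of its operands and adds their costs, whence the
    factor 3 in [expr_factor]. *)
Lemma cost_le (B : nat) (s : store) (e : expr) : bounded B s ->
  (data_size (eval s e) <= expr_factor e * B.+1)%N /\
  (expr_cost s e <= expr_factor e * B.+1)%N.
Proof.
move=> hB.
have B4 : (4 <= B)%N := leq_trans (data_size_ge4 _) (hB 0%N).
have L (p q : rat) : (rat_size (p <= q)%R%:R <= 2 * (rat_size p + rat_size q))%N.
  have := rat_size_bool (p <= q); have := rat_size_ge4 p.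
  by have := rat_size_ge4 q; lia.
have H op (d1 d2 : data) (k1 k2 X Y : nat) :
    (forall p q, (rat_size (op p q) <= 2 * (rat_size p + rat_size q))%N) ->
    (data_size d1 <= X)%N -> (data_size d2 <= Y)%N -> (k1 <= X)%N -> (k2 <= Y)%N ->
    (data_size (num_op op d1 d2) <= 3 * (X + Y) + 6 * B.+1)%N /\
    (data_size (num_op op d1 d2) + (k1 + k2) <= 3 * (X + Y) + 6 * B.+1)%N.
  by move=> /(num_op_size d1 d2) *; split; lia.
elim: e => [x|q|a [a1 a2] b [b1 b2]|a [a1 a2]|a [a1 a2]|a [a1 a2]
  |a [a1 a2] b [b1 b2]|a [a1 a2] b [b1 b2]|a [a1 a2] b [b1 b2]
  |a [a1 a2] b [b1 b2]|a [a1 a2] b [b1 b2]].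
- by rewrite /= addn0; have := hB x; lia.
- by rewrite /= addn0 mulnS; split; exact: leq_addr.
all: rewrite /= mulnDl -mulnA ?mulnDl.
all: try move: (expr_factor b * B.+1)%N b1 b2 => Y b1 b2.
all: move: (expr_factor a * B.+1)%N a1 a2 => X a1 a2.
- by split; lia.
- by case: (eval s a) a1 => [q|d1 d2]; rewrite /= ?rat_size0; split; lia.
- by case: (eval s a) a1 => [q|d1 d2]; rewrite /= ?rat_size0; split; lia.
- have h1 : (rat_size 1 <= 6)%N := rat_size_bool true.
  by case: (eval s a) a1 => [q|d1 d2]; rewrite /= ?rat_size0; split; lia.
- by apply: H => //; exact: rat_sizeD.
- by apply: H => //; exact: rat_sizeB.
- by apply: H => //; exact: rat_sizeM.
- by apply: H => //; exact: rat_size_div.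
- by apply: H => //; exact: L.
Qed.

(* Bound on the running time when every loop makes at most [I] iterations each
   time it is entered, and the registers have size at most [B]. *)
Fixpoint com_bound (I B : nat) (c : com) : nat :=
  match c with
  | CAssign _ e | CAskIndep _ e | CAskOlcpm _ e => (expr_factor e * B.+1).+1
  | CSeq a b => (com_bound I B a + com_bound I B b).+1
  | CIf e a b => (expr_factor e * B.+1 + com_bound I B a + com_bound I B b).+1
  | CWhile e a => (I.+1 * (expr_factor e * B.+1 + com_bound I B a).+1)%N
  end.

(** * Polynomially bounded functions *)

Definition poly_bounded (f : nat -> nat) :=
  exists b : {poly nat}, forall x, (f x <= b.[x])%N.

Lemma poly_bounded_const k : poly_bounded (fun=> k).
Proof. by exists k%:P => x; rewrite hornerC. Qed.

Lemma poly_bounded_id : poly_bounded id.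
Proof. by exists 'X => x; rewrite hornerX. Qed.

Lemma poly_boundedD f g :
  poly_bounded f -> poly_bounded g -> poly_bounded (fun x => f x + g x)%N.
Proof.
by move=> [b hb] [c hc]; exists (b + c) => x; rewrite hornerD; apply: leq_add.
Qed.

Lemma poly_boundedM f g :
  poly_bounded f -> poly_bounded g -> poly_bounded (fun x => f x * g x)%N.
Proof.
by move=> [b hb] [c hc]; exists (b * c) => x; rewrite hornerM; apply: leq_mul.
Qed.

Lemma poly_boundedS f : poly_bounded f -> poly_bounded (fun x => (f x).+1).
Proof.
move=> hf; have [b hb] := poly_boundedD (poly_bounded_const 1) hf.
by exists b.
Qed.

(** For a fixed program, [com_bound] is built from the two bounds by a fixed number of sums and
    products. *)
Lemma poly_bounded_com (I B : nat -> nat) (c : com) :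
  poly_bounded I -> poly_bounded B -> poly_bounded (fun x => com_bound (I x) (B x) c).
Proof.
move=> hI hB.
have hE e : poly_bounded (fun x => expr_factor e * (B x).+1)%N.
  exact: poly_boundedM (poly_bounded_const _) (poly_boundedS hB).
elim: c => [x e|c hc d hd|e c hc d hd|e c hc|x e|x e] /=.
- exact: poly_boundedS.
- by apply: poly_boundedS; apply: poly_boundedD.
- by apply: poly_boundedS; apply: poly_boundedD => //; apply: poly_boundedD.
- apply: poly_boundedM; first exact: poly_boundedS.
  by apply: poly_boundedS; apply: poly_boundedD.
- exact: poly_boundedS.
- exact: poly_boundedS.
Qed.

(** * Total correctness with time and size bounds *)

Section Wp.
Variables (n : nat) (M : matroid 'I_n) (O : olcpm -> rat).
Variables (I B : nat) (good : olcpm -> Prop).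

(** The size bound on registers is a premise and is restored at the end, so that assertions and loop
    invariants need not carry it. *)
Definition wp (c : com) (s : store) (Q : store -> Prop) : Prop :=
  bounded B s -> exists s' t q,
    [/\ exec M O c s s' t q, (t <= com_bound I B c)%N, List.Forall good q,
        bounded B s' & Q s'].

Lemma wp_conseq (c : com) (s : store) (Q Q' : store -> Prop) :
  (forall s', Q s' -> Q' s') -> wp c s Q -> wp c s Q'.
Proof.
move=> QQ' h /h [s' [t [q [h1 h2 h3 h4 h5]]]].
by exists s', t, q; split=> //; apply: QQ'.
Qed.

Lemma bounded_upd s x d :
  bounded B s -> (data_size d <= B)%N -> bounded B (upd s x d).
Proof. by move=> hs hd y; rewrite /upd; case: eqP. Qed.

Lemma wp_assign x e s (Q : store -> Prop) :
  (bounded B s -> (data_size (eval s e) <= B)%N) -> Q (upd s x (eval s e)) ->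
  wp (CAssign x e) s Q.
Proof.
move=> /[swap] hQ /[swap] hs /(_ hs) he; exists (upd s x (eval s e)), (expr_cost s e).+1, [::].
split=> //; [exact: ExecAssign | | exact: bounded_upd].
by have [_] := cost_le e hs.
Qed.

Lemma wp_seq c1 c2 s Q : wp c1 s (fun s' => wp c2 s' Q) -> wp (CSeq c1 c2) s Q.
Proof.
move=> h /h [s1 [t1 [q1 [e1 l1 g1 b1 /(_ b1) [s2 [t2 [q2 [e2 l2 g2 b2 hQ]]]]]]]].
exists s2, (t1 + t2).+1, (q1 ++ q2); split=> //.
- exact: ExecSeq e1 e2.
- by rewrite /= ltnS leq_add.
- exact/List.Forall_app.
Qed.

Lemma wp_if e c1 c2 s Q :
  wp (if truth (eval s e) then c1 else c2) s Q -> wp (CIf e c1 c2) s Q.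
Proof.
move=> h hs; have [s' [t [q [h1 h2 h3 h4 h5]]]] := h hs.
exists s', (expr_cost s e + t).+1, q; split=> //; first exact: ExecIf.
have [_ /=] := cost_le e hs; move: h2; rewrite /=; case: ifP => _; lia.
Qed.

(* [J k] is an invariant that allows for at most [k] further iterations. *)
Lemma wp_while e c (J : nat -> store -> Prop) k s Q :
  J k s -> (k <= I)%N ->
  (forall k s, J k s -> truth (eval s e) ->
     wp c s (fun s' => exists2 k', (k' < k)%N & J k' s')) ->
  (forall k s, J k s -> ~~ truth (eval s e) -> Q s) ->
  wp (CWhile e c) s Q.
Proof.
move=> Js kI hbody hend hs.
(* The time is bounded with the number [k] of iterations still allowed in place of [I], which makes
   induction on [k] possible. *)
suff [s' [t [q [h1 h2 h3 h4 h5]]]] : exists s' t q,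
    [/\ exec M O (CWhile e c) s s' t q,
        (t <= k.+1 * (expr_factor e * B.+1 + com_bound I B c).+1)%N,
        List.Forall good q, bounded B s' & Q s'].
  exists s', t, q; split=> //; apply: leq_trans h2 _.
  by rewrite /= leq_mul2r ltnS kI orbT.
elim/ltn_ind: k s Js hs {kI} => k IH s Js hs.
have [_ he] := cost_le e hs.
have [tr|ntr] := boolP (truth (eval s e)); last first.
  exists s, (expr_cost s e).+1, [::]; split=> //; last exact: hend Js ntr.
  - exact: ExecWhileStop.
  - by rewrite mulSn; lia.
have [s1 [t1 [q1 [e1 l1 g1 b1 [k' kk' J1]]]]] := hbody _ _ Js tr hs.
have [s2 [t2 [q2 [e2 l2 g2 b2 hQ]]]] := IH k' kk' s1 J1 b1.
exists s2, (expr_cost s e + t1 + t2).+1, (q1 ++ q2); split=> //.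
- exact: ExecWhileLoop e1 e2.
- move: he l1 l2 => he l1 l2.
  have := leq_mul kk' (leqnn (expr_factor e * B.+1 + com_bound I B c).+1).
  rewrite mulSn; move: l2; set F := (_ * B.+1)%N in he *; lia.
- exact/List.Forall_app.
Qed.

Lemma wp_ask_indep x e s (l : seq 'I_n) (Q : store -> Prop) :
  eval s e = enc_elts l ->
  (6 <= B)%N ->
  Q (upd s x (Atom ([set i in l] \in indep M)%:R)) -> wp (CAskIndep x e) s Q.
Proof.
move=> he B6 hQ hs.
exists (upd s x (Atom ([set i in l] \in indep M)%:R)), (expr_cost s e).+1, [::].
split=> //; [exact: ExecAskIndep | | ].
  by have [_] := cost_le e hs.
by apply: bounded_upd => //=; apply: leq_trans (rat_size_bool _) B6.
Qed.

(** The size of a query is controlled through the data encoding it, which [cost_le] bounds; [good q]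
    may be derived from that bound. *)
Lemma wp_ask_olcpm x e s N m (f : {ffun 'I_N -> 'I_n})
    (c : {ffun 'I_N -> rat}) (v p : 'M[rat]_(N, m)) (Q : store -> Prop) :
  let q := Olcpm (parallel M f) c v p in
  eval s e = enc_query f c v p ->
  ((data_size (eval s e) <= expr_factor e * B.+1)%N -> good q) ->
  (rat_size (O q) <= B)%N ->
  Q (upd s x (Atom (O q))) -> wp (CAskOlcpm x e) s Q.
Proof.
move=> q he hg hO hQ hs.
exists (upd s x (Atom (O q))), (expr_cost s e).+1, [:: q].
have [h1 h2] := cost_le e hs.
split=> //; [exact: ExecAskOlcpm | | exact: bounded_upd].
by apply: List.Forall_cons; [exact: hg | exact: List.Forall_nil].
Qed.
End Wp.

(** Submitting a query takes at least one unit of time. *)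
Lemma exec_queries_le (n : nat) (M : matroid 'I_n) (O : olcpm -> rat) c s s' t q :
  exec M O c s s' t q -> (size q <= t)%N.
Proof. by elim=> * //=; rewrite ?size_cat; lia. Qed.

(** * Rank and spanning *)

Section Rank.
Variables (E : finType) (M : matroid E).
Implicit Types (T J : {set E}) (a : E).

Lemma leq_rank J T : J \in indep M -> J \subset T -> (#|J| <= rank M T)%N.
Proof. by move=> iJ sJ; apply: (@leq_bigmax_cond _ _ _ J); rewrite iJ. Qed.

Definition basis T : {set E} :=
  [arg max_(J > set0 | (J \in indep M) && (J \subset T)) #|J|]%N.

Lemma basisP T :
  [/\ basis T \in indep M, basis T \subset T & #|basis T| = rank M T].
Proof.
rewrite /basis; case: arg_maxnP => [|J /andP[iJ sJ] maxJ].
  by rewrite indep_set0 sub0set.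
split=> //; apply/eqP; rewrite eqn_leq leq_rank //=.
by apply/bigmax_leqP => K hK; apply: maxJ.
Qed.

Lemma rankS T T' : T \subset T' -> (rank M T <= rank M T')%N.
Proof.
move=> sT; have [iJ sJ <-] := basisP T.
exact: leq_rank iJ (subset_trans sJ sT).
Qed.

Lemma rank0 : rank M set0 = 0%N.
Proof.
by have [_ s0 <-] := basisP set0; apply/eqP; rewrite cards_eq0 -subset0.
Qed.

Definition unspanned a T : bool := (rank M T).+1 == rank M (a |: T).

Lemma rankU1_leS a T : (rank M (a |: T) <= (rank M T).+1)%N.
Proof.
have [iJ sJ <-] := basisP (a |: T); rewrite (cardsD1 a) -add1n leq_add ?leq_b1 //.
apply: leq_rank; first exact: indep_sub (subD1set _ _) iJ.
by rewrite subDset.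
Qed.

Lemma rankU1 a T : rank M (a |: T) = (rank M T + unspanned a T)%N.
Proof.
have := rankU1_leS a T; have := rankS (subsetUr [set a] T).
by rewrite /unspanned; case: eqP => /=; lia.
Qed.

Lemma rank1 a : rank M [set a] = ([set a] \in indep M).
Proof.
have [iJ sJ cJ] := basisP [set a]; case h: (_ \in _).
  apply/eqP; rewrite eqn_leq -[X in (X <= _)%N]cJ.
  have := subset_leq_card sJ; rewrite cards1 => -> /=.
  by rewrite -[X in (X <= _)%N](cards1 a) leq_rank.
rewrite -cJ; move: sJ iJ; rewrite subset1 => /orP[] /eqP ->; first by rewrite h.
by rewrite cards0.
Qed.

(** If [a] is a loop, no independent set contains it, and adding it to [T] leaves the rank
    unchanged. *)
Lemma rankU1_le a T : (rank M (a |: T) <= rank M [set a] + rank M T)%N.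
Proof.
rewrite rank1; case h: (_ \in _); first exact: rankU1_leS.
have [iJ sJ <-] := basisP (a |: T); apply: leq_rank => //.
apply/subsetP => x xJ; have := subsetP sJ x xJ; rewrite !inE.
case: eqP => [xa|] //= _; move: h; rewrite (indep_sub _ iJ) //.
by rewrite sub1set -{1}xa.
Qed.

End Rank.

(** An independent set of copies maps injectively to an independent set; conversely, one copy in [T]
    is chosen for each element of a basis of the image. *)
Lemma rank_parallel (E E' : finType) (M : matroid E) (f : E' -> E) (T : {set E'}) :
  rank (parallel M f) T = rank M (f @: T).
Proof.
apply/eqP; rewrite eqn_leq; apply/andP; split.
  have [iJ sJ <-] := basisP (parallel M f) T.
  move: iJ; rewrite inE => /andP[/eqP <- iJ].
  exact: leq_rank iJ (imsetS _ sJ).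
have [iJ sJ <-] := basisP M (f @: T); set J := basis _ _ in iJ sJ *.
have [->|[y0 y0J]] := set_0Vmem J; first by rewrite cards0.
have /imsetP[x0 x0T _] := subsetP sJ _ y0J.
(* A copy of [y] lying in [T]; the default [x0] is never taken for [y] in [J]. *)
pose g y := odflt x0 [pick x in T | f x == y].
have gP y : y \in J -> g y \in T /\ f (g y) = y.
  move=> /(subsetP sJ) /imsetP[x xT ->]; rewrite /g.
  by case: pickP => [z /andP[zT /eqP]|/(_ x)] //=; rewrite xT eqxx.
have fgJ : f @: (g @: J) = J.
  by rewrite -imset_comp -[RHS]imset_id; apply: eq_in_imset => y /gP[].
have gJ : #|g @: J| = #|J|.
  by apply: card_in_imset => y z /gP[_ {2}<-] /gP[_ {2}<-] ->.
rewrite -gJ; apply: leq_rank; first by rewrite inE fgJ gJ eqxx.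
by apply/subsetP => _ /imsetP[y /gP[yT _] ->].
Qed.

(** * Expectations over random sets *)

(* The expectation of [g] at the union of independent random singletons: [{i}]
   is present with probability [p] for each entry [(i, p)]. *)
Fixpoint Ex (E : finType) (l : seq (E * rat)) (g : {set E} -> rat) : rat :=
  if l is (i, p) :: l' then
    p * Ex l' (fun A => g (i |: A)) + (1 - p) * Ex l' g
  else g set0.

Section Expectation.
Variable E : finType.
Implicit Types (l : seq (E * rat)) (g : {set E} -> rat).

Definition probs l : Prop := forall x, x \in l -> 0 <= x.2 <= 1.

Lemma probs_cons x l : probs (x :: l) <-> (0 <= x.2 <= 1) /\ probs l.
Proof.
split=> [h|[hx h] y]; last by rewrite inE => /predU1P[->|/h].
by split=> [|y yl]; apply: h; rewrite inE ?eqxx ?yl ?orbT.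
Qed.

Lemma Ex_eq_in l g g' :
  (forall A : {set E}, A \subset [set i in map fst l] -> g A = g' A) ->
  Ex l g = Ex l g'.
Proof.
elim: l g g' => [|[i p] l IH] g g' /= h; first exact: h (sub0set _).
have sub (A : {set E}) : A \subset [set j in map fst l] ->
    A \subset [set j in i :: map fst l].
  by move=> /subsetP sA; apply/subsetP => x /sA; rewrite !inE => ->; rewrite orbT.
congr (_ * _ + _ * _); apply: IH => A sA; apply: h; last exact: sub.
by rewrite subUset (sub _ sA) andbT sub1set !inE eqxx.
Qed.

Lemma eq_Ex l g g' : g =1 g' -> Ex l g = Ex l g'.
Proof. by move=> h; apply: Ex_eq_in => A _; apply: h. Qed.

Lemma ExD l g g' : Ex l (fun A => g A + g' A) = Ex l g + Ex l g'.
Proof. by elim: l g g' => [|[i p] l IH] g g' //=; rewrite !IH; ring. Qed.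

Lemma ExN l g : Ex l (fun A => - g A) = - Ex l g.
Proof. by elim: l g => [|[i p] l IH] g //=; rewrite !IH; ring. Qed.

Lemma Ex_const l (k : rat) : Ex l (fun=> k) = k.
Proof. by elim: l => [|[i p] l IH] //=; rewrite !IH; ring. Qed.

Lemma Ex_ge0 l g : probs l -> (forall A, 0 <= g A) -> 0 <= Ex l g.
Proof.
elim: l g => [|[i p] l IH] g //= /probs_cons[/= /andP[p0 p1] hl] h.
by rewrite addr_ge0 ?mulr_ge0 ?subr_ge0 ?IH.
Qed.

Lemma Ex_le l g g' : probs l -> (forall A, g A <= g' A) -> Ex l g <= Ex l g'.
Proof.
move=> hl h; rewrite -subr_ge0 -ExN -ExD.
by apply: Ex_ge0 => // A; rewrite subr_ge0.
Qed.

(** An entry of probability 0 contributes only the branch without it. This discards the dummy copies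
    that pad the queries. *)
Lemma Ex_filter (P : pred (E * rat)) l g :
  (forall x, x \in l -> ~~ P x -> x.2 = 0) -> Ex (filter P l) g = Ex l g.
Proof.
elim: l g => [|[i p] l IH] g //= h.
have hl x : x \in l -> ~~ P x -> x.2 = 0.
  by move=> xl; apply: h; rewrite inE xl orbT.
case: ifP => [_|/negbT nP] /=; rewrite !IH //.
have -> : p = 0 by apply: (h (i, p)); rewrite ?mem_head.
by rewrite mul0r add0r subr0 mul1r.
Qed.

(** Clearing the denominator of each entry in turn leaves integer combinations of integers. Hence
    the grid on which the binary search runs. *)
Lemma Ex_int l g : (forall A, g A \is a Num.int) ->
  (\prod_(x <- l) (denq x.2)%:~R) * Ex l g \is a Num.int.
Proof.
elim: l g => [|[i p] l IH] g h; first by rewrite big_nil mul1r; exact: h.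
rewrite big_cons /=; set D := \prod_(x <- l) _ in IH *.
have -> : (denq p)%:~R * D * (p * Ex l (fun A => g (i |: A)) + (1 - p) * Ex l g)
    = (numq p)%:~R * (D * Ex l (fun A => g (i |: A)))
      + ((denq p)%:~R - (numq p)%:~R) * (D * Ex l g).
  by rewrite numqE; ring.
by apply: rpredD; apply: rpredM; rewrite ?rpredB ?intr_int //; apply: IH.
Qed.

Lemma powerset_split (D : {set E}) (j : E) (F : {set E} -> rat) : j \notin D ->
  \sum_(T : {set E} | T \subset j |: D) F T =
  \sum_(T : {set E} | T \subset D) F (j |: T) + \sum_(T : {set E} | T \subset D) F T.
Proof.
move=> jD; rewrite (bigID (fun T : {set E} => j \in T)) /=; congr (_ + _).
  rewrite (reindex_onto (setU [set j]) (fun T => T :\ j)) /=; last first.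
    by move=> T /andP[_ jT]; rewrite setD1K.
  apply: eq_bigl => T; rewrite setU11 andbT.
  have [sT|nsT] := boolP (T \subset D).
    have jT : j \notin T by apply: contra jD; apply: subsetP.
    by rewrite setUS // setU1K ?eqxx.
  apply/negbTE; rewrite negb_and; have [jT|jT] := boolP (j \in T).
    apply/orP; right; apply: contraTN jT => /eqP <-.
    by rewrite !inE eqxx.
  apply/orP; left; apply: contra nsT => sT.
  apply/subsetP => x xT; have := subsetP sT x; rewrite !inE xT orbT => /(_ isT).
  by case: eqP => // xj; rewrite -xj xT in jT.
apply: eq_bigl => T; apply/andP/idP => [[sT jT]|sT].
  apply/subsetP => x xT; have := subsetP sT x xT; rewrite !inE.
  by case: eqP => // xj; rewrite -xj xT in jT.
split; first exact: subset_trans sT (subsetUr _ _).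
by apply: contra jD; apply: subsetP.
Qed.

(** Splitting the subsets by membership of the head gives the two branches of [Ex]. Uniqueness
    matters: a product over a set counts a repeated element once, [Ex] each time it is listed. *)
Lemma Ex_sum (s : seq E) (p : E -> rat) g : uniq s ->
  \sum_(T : {set E} | T \subset [set i in s])
    (\prod_(i in T) p i) * (\prod_(i in [set i in s] :\: T) (1 - p i)) * g T
  = Ex [seq (i, p i) | i <- s] g.
Proof.
elim: s g => [|j s IH] g /=.
  move=> _; rewrite (big_pred1 set0) => [|T]; last first.
    by rewrite [[set i in [::]]](_ : _ = set0) ?subset0 //; apply/setP => x; rewrite !inE.
  rewrite setD0 !big_pred0 ?mul1r // => x; by rewrite !inE.
move=> /andP[js us]; set D := [set i in s].
have jD : j \notin D by rewrite inE.
have -> : [set i in j :: s] = j |: D by apply/setP => x; rewrite !inE.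
rewrite powerset_split // -!IH // !big_distrr /=; congr (_ + _).
  apply: eq_bigr => T sT; have jT : j \notin T by apply: contra jD; apply: subsetP.
  rewrite big_setU1 //= [(j |: D) :\: _](_ : _ = D :\: T); first by ring.
  apply/setP => x; rewrite !inE; case: eqP => //= ->.
  by rewrite (negPf js) andbF.
apply: eq_bigr => T sT; have jT : j \notin T by apply: contra jD; apply: subsetP.
have -> : (j |: D) :\: T = j |: (D :\: T).
  by apply/setP => x; rewrite !inE; case: eqP => //= ->; rewrite (negPf jT).
by rewrite big_setU1 /=; [ring | rewrite !inE (negPf js) andbF].
Qed.

End Expectation.

Lemma Ex_imset (E E' : finType) (f : E -> E') (l : seq (E * rat))
    (g : {set E'} -> rat) :
  Ex l (fun A => g (f @: A)) = Ex [seq (f x.1, x.2) | x <- l] g.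
Proof.
elim: l g => [|[i p] l IH] g /=; first by rewrite imset0.
by rewrite -!IH; congr (_ * _ + _); apply: eq_Ex => A; rewrite imsetU1.
Qed.

(** * Expected rank and probability of not being spanned *)

Section RankExpectation.
Variables (E : finType) (M : matroid E).
Implicit Types (l : seq (E * rat)) (a : E).

Definition exp_rank l : rat := Ex l (fun A => (rank M A)%:R).
Definition prob_unspanned a l : rat := Ex l (fun A => (unspanned M a A)%:R).

Lemma exp_rank_cons a p l :
  exp_rank ((a, p) :: l) = exp_rank l + p * prob_unspanned a l.
Proof.
rewrite /exp_rank /=.
under [X in p * X]eq_Ex do rewrite rankU1 natrD.
by rewrite ExD -/(prob_unspanned a l); ring.
Qed.

Lemma prob_unspanned_bounds a l : probs l -> 0 <= prob_unspanned a l <= 1.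
Proof.
move=> hl; rewrite Ex_ge0 // -(Ex_const l 1) Ex_le // => A.
by case: unspanned.
Qed.

Lemma exp_rank_le l : probs l -> exp_rank l <= (size l)%:R.
Proof.
elim: l => [|[i p] l IH]; first by rewrite /exp_rank /= rank0.
move=> /probs_cons[/= /andP[p0 p1] hl]; rewrite exp_rank_cons -natr1.
by have /andP[q0 q1] := prob_unspanned_bounds i hl; rewrite lerD ?IH // mulr_ile1.
Qed.

(** For every [A], the indicator of [unspanned M a A] is at most the rank of [[set a]], which is at
    most that indicator plus the rank of [A]. Taking expectations encloses the probability. *)
Lemma prob_unspanned_rank0 a l : probs l -> exp_rank l = 0 ->
  prob_unspanned a l = ([set a] \in indep M)%:R.
Proof.
move=> hl r0; apply/eqP; rewrite -rank1 eq_le; apply/andP; split.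
  rewrite -[leRHS](Ex_const l); apply: Ex_le => // A; rewrite ler_nat.
  by have := rankU1_le M a A; rewrite rankU1; lia.
rewrite -subr_le0 -[X in _ <= X]r0 -[X in X - _](Ex_const l) -ExN -ExD.
apply: Ex_le => // A; rewrite lerBlDr -natrD ler_nat -rankU1.
by apply: rankS; apply: subsetUl.
Qed.
End RankExpectation.

(** * The contract instance with a single costly element *)

Section Expect.
Variables (R : realType) (I : olcpm) (X : 'I_(oN I) -> rat).
Hypothesis XP : forall i, exists k, X i = oval I i k.
Local Notation E := 'I_(oN I).
Implicit Types (pay : {set E} -> {set E} -> R) (S J : {set E}) (t : strategy R E).

Lemma eq_expect pay pay' S t : (forall J S', pay J S' = pay' J S') ->
  expect X pay S t = expect X pay' S t.
Proof.
move=> h; elim: t S => [J|i next IH|k w u IH] S //=.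
by apply: eq_bigr => j _; rewrite IH.
Qed.

(** Feasibility only constrains the branches taken after listed values, and [XP] keeps the run on
    those branches; the comparison then takes place at the leaves. *)
Lemma expect_le pay pay' S t : feasible_from S t ->
  (forall J S', J \subset S' -> J \in indep (omat I) -> pay J S' <= pay' J S') ->
  expect X pay S t <= expect X pay' S t.
Proof.
move=> ft h; elim: t S ft => [J|i next IH|k w u IH] S /=.
- by case=> sJ iJ; apply: h.
- by case=> _ hn; apply: IH; have [k ->] := XP i.
- case=> w0 _ hu; apply: ler_sum => j _.
  by apply: ler_wpM2l => //; apply: IH.
Qed.

Lemma expect_lin (y z : R) pay pay' S t :
  expect X (fun J S => y * pay J S + z * pay' J S) S t
  = y * expect X pay S t + z * expect X pay' S t.
Proof.
elim: t S => [J|i next IH|k w u IH] S //=.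
by rewrite !big_distrr -big_split /=; apply: eq_bigr => j _; rewrite IH; ring.
Qed.

Lemma expect_const (y : R) S t : feasible_from S t ->
  expect X (fun _ _ => y) S t = y.
Proof.
elim: t S => [J|i next IH|k w u IH] S //=.
  by case=> _ hn; apply: IH; have [k ->] := XP i.
case=> _ w1 hu; rewrite -[RHS]mul1r -w1 big_distrl /=.
by apply: eq_bigr => j _; rewrite IH.
Qed.

(** In continuation style: [A] collects the probed elements observed to have value 1, and [k]
    decides what to do from this set alone. *)
Fixpoint probe_all (s : seq E) (A : {set E}) (k : {set E} -> strategy R E) :
    strategy R E :=
  if s is i :: s' then
    Probe i (fun v => probe_all s' (if v == 1 then i |: A else A) k)
  else k A.

Lemma expect_probe_all pay s A k S :
  expect X pay S (probe_all s A k) =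
  expect X pay ([set i in s] :|: S) (k ([set i in s | X i == 1] :|: A)).
Proof.
elim: s A S => [|i s IH] A S /=.
  by congr (expect X pay _ (k _)); apply/setP => j; rewrite !inE.
rewrite IH; congr (expect X pay _ (k _)); apply/setP => j; rewrite !inE.
  by case: (j == i); rewrite ?orbT.
by case: (eqVneq j i) => [->|ji]; case: (X i =P 1) => ?;
  rewrite ?inE ?eqxx ?(negPf ji) ?orbT ?andbF.
Qed.

End Expect.

Lemma feasible_probe_all (R : realType) (I : olcpm) (s : seq 'I_(oN I))
    (A S : {set 'I_(oN I)}) (k : {set 'I_(oN I)} -> strategy R 'I_(oN I)) :
  uniq s -> [disjoint S & [set i in s]] -> A \subset S ->
  (forall B : {set 'I_(oN I)}, B \subset A :|: [set i in s] ->
     feasible_from ([set i in s] :|: S) (k B)) ->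
  feasible_from S (probe_all s A k).
Proof.
elim: s A S => [|i s IH] A S /=.
  have -> : [set i in [::] : seq 'I_(oN I)] = set0 by apply/setP => j; rewrite !inE.
  by move=> _ _ _; rewrite set0U setU0; apply.
move=> /andP[is_ us] /pred0P dS sA hk; split.
  by have := dS i; rewrite !inE eqxx andbT => ->.
have eS : [set j in s] :|: (i |: S) = [set j in i :: s] :|: S.
  by apply/setP => j; rewrite !inE; case: (j == i); rewrite ?orbT.
move=> v; apply: IH => //.
- apply/pred0P => j /=; rewrite !inE; have := dS j; rewrite /= !inE.
  by case: eqP => [->|] //=; rewrite (negPf is_).
- case: ifP => _; first exact: setUS.
  exact: subset_trans sA (subsetUr _ _).
- move=> B sB; rewrite eS; apply: hk; apply: subset_trans sB _.
  apply/subsetP => j; rewrite !inE; case: ifP => _; rewrite ?inE.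
    by case: (j == i); rewrite ?orbT.
  by case/orP=> ->; rewrite ?orbT.
Qed.

(** * Zero-one instances with one costly element that almost surely has value 1 *)

Section Instance.
Variables (R : realType) (I : olcpm) (a : 'I_(oN I)) (c : rat).
Local Notation E := 'I_(oN I).
Local Notation M := (omat I).
Hypothesis validI : olcpm_valid I.
Hypothesis val01 : forall i k, (oval I i k == 0) || (oval I i k == 1).
Hypothesis costI : forall i, ocost I i = if i == a then c else 0.
Hypothesis val_a : forall k, oprob I a k != 0 -> oval I a k = 1.
Hypotheses (c0 : 0 < c) (c1 : c <= 1).
Implicit Types (x : profile I) (t : strategy R E) (J S : {set E}).

Definition ones x : {set E} := [set i | profile_val x i == 1].

Definition inst_rank : rat := \sum_x profile_prob x * (rank M (ones x :\ a))%:R.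
Definition inst_unspanned : rat :=
  \sum_x profile_prob x * (unspanned M a (ones x :\ a))%:R.

Definition avg (pay : profile I -> {set E} -> {set E} -> R) t : R :=
  \sum_x ratr (profile_prob x) * expect (profile_val x) (pay x) set0 t.

Lemma profile_valP x i : exists k, profile_val x i = oval I i k.
Proof. by exists (x i). Qed.

Lemma profile_prob_ge0 x : 0 <= ratr (profile_prob x) :> R.
Proof. by rewrite ler0q; have [_ _ p0 _] := validI; apply: prodr_ge0. Qed.

Lemma eq_avg pay pay' t : (forall x J S, pay x J S = pay' x J S) ->
  avg pay t = avg pay' t.
Proof. by move=> h; apply: eq_bigr => x _; congr (_ * _); apply: eq_expect. Qed.

Lemma avg_le pay pay' t : feasible t ->
  (forall x J S, J \subset S -> J \in indep M -> pay x J S <= pay' x J S) ->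
  avg pay t <= avg pay' t.
Proof.
move=> ft h; apply: ler_sum => x _.
apply: ler_wpM2l; first exact: profile_prob_ge0.
by apply: expect_le => //; [exact: profile_valP | exact: h].
Qed.

Lemma avg_lin (y z : R) pay pay' t :
  avg (fun x J S => y * pay x J S + z * pay' x J S) t
  = y * avg pay t + z * avg pay' t.
Proof.
rewrite /avg !big_distrr -big_split /=; apply: eq_bigr => x _.
by rewrite expect_lin; ring.
Qed.

Lemma avg_profile (g : profile I -> rat) t : feasible t ->
  avg (fun x _ _ => ratr (g x)) t = ratr (\sum_x profile_prob x * g x).
Proof.
move=> ft; rewrite /avg rmorph_sum; apply: eq_bigr => x _.
by rewrite rmorphM /= expect_const //; exact: profile_valP.
Qed.

(** The payment depends on the number of ones returned, the cost on whether [a] was probed; both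
    utilities are therefore linear in the averages of these two quantities. *)
Definition reward (x : profile I) J S : R := #|J :&: ones x|%:R.
Definition probed (x : profile I) J S : R := (a \in S)%:R.

Lemma sum_val x J : \sum_(i in J) ratr (profile_val x i) = reward x J J.
Proof.
rewrite /reward -sum1_card natr_sum (big_setID (ones x)) /=.
rewrite [X in _ + X]big1 ?addr0 => [|i].
  by apply: eq_bigr => i; rewrite !inE => /andP[_ /eqP ->]; rewrite rmorph1.
rewrite !inE => /andP[n1 _]; have := val01 i (x i).
by rewrite -/(profile_val x i) (negPf n1) orbF => /eqP ->; rewrite rmorph0.
Qed.

Lemma sum_cost S : \sum_(i in S) ratr (ocost I i) = ratr c * (a \in S)%:R :> R.
Proof.
have [aS|aS] := boolP (a \in S).
  rewrite (bigD1 a) //= costI eqxx mulr1 big1 ?addr0 // => i /andP[_ /negPf ia].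
  by rewrite costI ia rmorph0.
rewrite mulr0 big1 // => i iS; rewrite costI; case: eqP => [ia|]; last by rewrite rmorph0.
by rewrite -ia iS in aS.
Qed.

Lemma agent_utilityE (al : R) t :
  agent_utility al t = al * avg reward t - ratr c * avg probed t.
Proof.
rewrite -mulNr -avg_lin; apply: eq_avg => x J S.
by rewrite sum_val sum_cost mulNr.
Qed.

Lemma principal_utilityE (al : R) t :
  principal_utility al t = (1 - al) * avg reward t.
Proof.
transitivity (avg (fun x J S => (1 - al) * reward x J S + 0 * reward x J S) t).
  by apply: eq_avg => x J S; rewrite sum_val mul0r addr0.
by rewrite avg_lin mul0r addr0.
Qed.

(** The returned ones form an independent subset of [ones x], which can contain [a] only if [a] was
    probed. *)
Lemma reward_le x J S : J \subset S -> J \in indep M ->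
  reward x J S <= (rank M (ones x :\ a))%:R
    + (a \in S)%:R * (unspanned M a (ones x :\ a))%:R.
Proof.
move=> sJ iJ; rewrite /reward -natrM -natrD ler_nat.
have iJ1 : J :&: ones x \in indep M := indep_sub (subsetIl _ _) iJ.
have [aS|aS] := boolP (a \in S).
  rewrite mul1n -rankU1; apply: leq_rank => //.
  by apply/subsetP => i; rewrite !inE; case: (i == a) => //= /andP[].
rewrite mul0n addn0; apply: leq_rank => //.
apply/subsetP => i; rewrite !inE => /andP[iJ2 ->]; rewrite andbT.
by apply: contra aS => /eqP <-; apply: (subsetP sJ).
Qed.

Lemma avg_probed_ge0 t : feasible t -> 0 <= avg probed t.
Proof.
move=> ft; have <- : avg (fun _ _ _ => ratr 0) t = 0.
  by rewrite (avg_profile (fun=> 0)) // big1 ?rmorph0 // => x _; rewrite mulr0.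
by apply: avg_le => // x J S _ _; rewrite rmorph0 ler0n.
Qed.

(** The product of indicators in [reward_le] is bounded by its first factor here, and by its second
    one in [avg_reward_le]. *)
Lemma avg_reward_le_probed t : feasible t ->
  avg reward t <= ratr inst_rank + avg probed t.
Proof.
move=> ft; rewrite -(avg_profile _ ft) -[X in X + _]mul1r -[X in _ + X]mul1r -avg_lin.
apply: avg_le => // x J S sJ iJ; apply: le_trans (reward_le x sJ iJ) _.
by rewrite !mul1r ratr_nat lerD2l /probed -natrM ler_nat; case: (a \in S); case: unspanned.
Qed.

Lemma avg_reward_le t : feasible t ->
  avg reward t <= ratr (inst_rank + inst_unspanned).
Proof.
move=> ft; rewrite rmorphD /= -!(avg_profile _ ft) -[X in X + _]mul1r.
rewrite -[X in _ + X]mul1r -avg_lin.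
apply: avg_le => // x J S sJ iJ; apply: le_trans (reward_le x sJ iJ) _.
by rewrite !mul1r !ratr_nat lerD2l -natrM ler_nat; case: (a \in S); case: unspanned.
Qed.

Local Notation others := (enum [set~ a]).

Definition probe_free : strategy R E :=
  probe_all others set0 (fun A => Halt R (basis M A)).

(** The costly element comes last, when it is known whether its value, almost surely 1, would
    increase the reward. *)
Definition probe_unspanned : strategy R E :=
  probe_all others set0 (fun A =>
    if unspanned M a A then Probe a (fun=> Halt R (basis M (a |: A)))
    else Halt R (basis M A)).

Lemma set_others : [set i in others] = [set~ a].
Proof. by apply/setP => i; rewrite inE mem_enum. Qed.

Lemma ones_others x : [set i in others | profile_val x i == 1] = ones x :\ a.
Proof. by apply/setP => i; rewrite !inE mem_enum !inE. Qed.

Lemma feasible_probe_free : feasible probe_free.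
Proof.
apply: feasible_probe_all; rewrite ?enum_uniq ?sub0set //.
  by apply/pred0P => i /=; rewrite inE.
move=> B; rewrite set0U setU0 => sB /=; have [iJ sJ _] := basisP M B.
by split=> //; apply: subset_trans sB.
Qed.

Lemma feasible_probe_unspanned : feasible probe_unspanned.
Proof.
apply: feasible_probe_all; rewrite ?enum_uniq ?sub0set //.
  by apply/pred0P => i /=; rewrite inE.
move=> B; rewrite set0U setU0 => sB /=; case: ifP => _ /=.
  split=> [|_]; first by rewrite set_others !inE eqxx.
  have [iJ sJ _] := basisP M (a |: B).
  by split=> //; apply: subset_trans sJ _; apply: setUS.
have [iJ sJ _] := basisP M B.
by split=> //; apply: subset_trans sB.
Qed.

Lemma avg_probe_free :
  avg reward probe_free = ratr inst_rank /\ avg probed probe_free = 0.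
Proof.
split; last first.
  apply: big1 => x _; rewrite expect_probe_all /= /probed set_others.
  by rewrite !inE eqxx mulr0.
rewrite /avg rmorph_sum; apply: eq_bigr => x _.
rewrite rmorphM /= ratr_nat expect_probe_all /= setU0 ones_others /reward.
have [_ sJ <-] := basisP M (ones x :\ a); rewrite (setIidPl _) //.
by apply: subset_trans sJ (subsetDl _ _).
Qed.

Lemma prob_val_a x : profile_prob x != 0 -> a \in ones x.
Proof.
rewrite inE /profile_prob (bigD1 a) //= mulf_eq0 negb_or => /andP[pa _].
by rewrite /profile_val val_a.
Qed.

Lemma avg_probe_unspanned :
  avg reward probe_unspanned = ratr (inst_rank + inst_unspanned) /\
  avg probed probe_unspanned = ratr inst_unspanned.
Proof.
split; rewrite /avg.
  rewrite -big_split rmorph_sum; apply: eq_bigr => x _ /=.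
  rewrite -mulrDr rmorphM /= -natrD -rankU1 ratr_nat.
  have [->|px] := eqVneq (profile_prob x) 0; first by rewrite rmorph0 !mul0r.
  congr (_ * _); rewrite expect_probe_all !setU0 ones_others.
  case: ifP => ua /=; rewrite /reward; last first.
    rewrite rankU1 ua addn0; have [_ sJ <-] := basisP M (ones x :\ a).
    by rewrite (setIidPl _) //; apply: subset_trans sJ (subsetDl _ _).
  have [_ sJ <-] := basisP M (a |: ones x :\ a); rewrite (setIidPl _) //.
  by apply: subset_trans sJ _; rewrite setD1K // prob_val_a.
rewrite rmorph_sum; apply: eq_bigr => x _ /=.
rewrite rmorphM /= ratr_nat expect_probe_all !setU0 ones_others.
congr (_ * _); rewrite /probed.
by case: ifP => ua /=; rewrite set_others !inE eqxx.
Qed.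

Lemma inst_ge0 : 0 <= inst_rank /\ 0 <= inst_unspanned.
Proof.
have [_ _ p0 _] := validI.
by split; apply: sumr_ge0 => x _; rewrite mulr_ge0 // prodr_ge0.
Qed.

(** Let [r], [h] be the averages of [reward] and [probed], and [r0] the expected rank. Preferring
    [t] to [probe_free] means [al * r - c * h >= al * r0]; with [r <= r0 + h] this yields
    [(c - al) * (r - r0) <= 0]. *)
Lemma agent_optimal_reward (al : R) t : al < ratr c -> agent_optimal al t ->
  avg reward t <= ratr inst_rank.
Proof.
move=> alc [ft /(_ _ feasible_probe_free)]; rewrite !agent_utilityE.
have [-> ->] := avg_probe_free.
have := avg_reward_le_probed ft.
have c0' : 0 < ratr c :> R by rewrite ltr0q.
move: (avg reward t) (avg probed t) (ratr inst_rank) => r h r0 h1 h2.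
rewrite -subr_ge0 -(pmulr_rge0 _ (_ : 0 < ratr c - al)) ?subr_gt0 //.
have : ratr c * r <= ratr c * (r0 + h) by rewrite ler_wpM2l // ltW.
nra.
Qed.

Lemma principal_value_free : principal_value I (0 : R) (ratr inst_rank).
Proof.
exists probe_free; last by rewrite principal_utilityE subr0 mul1r; case: avg_probe_free.
split; last first.
  move=> t ot; rewrite !principal_utilityE subr0 !mul1r.
  have [-> _] := avg_probe_free.
  by apply: agent_optimal_reward ot; rewrite ltr0q.
split; first exact: feasible_probe_free.
move=> t ft; rewrite !agent_utilityE !mul0r; have [_ ->] := avg_probe_free.
by rewrite mulr0 subr0 sub0r oppr_le0 mulr_ge0 ?avg_probed_ge0 // ler0q ltW.
Qed.

(** At [alpha = c] the agent earns at most [c * inst_rank], whether or not unspanned costly elements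
    are probed. Ties are broken in favour of the principal, so [probe_unspanned] is a best
    response. *)
Lemma principal_value_unspanned :
  principal_value I (ratr c : R) ((1 - ratr c) * ratr (inst_rank + inst_unspanned)).
Proof.
have c1' : 0 <= 1 - ratr c :> R by rewrite subr_ge0 -(rmorph1 ratr) ler_rat.
exists probe_unspanned; last first.
  by rewrite principal_utilityE; have [-> _] := avg_probe_unspanned.
split; last first.
  move=> t [ft _]; rewrite !principal_utilityE; have [-> _] := avg_probe_unspanned.
  by rewrite ler_wpM2l // avg_reward_le.
split; first exact: feasible_probe_unspanned.
move=> t ft; rewrite !agent_utilityE; have [-> ->] := avg_probe_unspanned.
rewrite rmorphD /=; have : ratr c * avg reward t <= ratr c * (ratr inst_rank + avg probed t).
  by apply: ler_wpM2l; [rewrite ler0q ltW | exact: avg_reward_le_probed].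
lra.
Qed.

(** An optimal contract must do at least as well as [0] and [c]. On either side of [c] its value is
    at most [1 - al] times a positive constant attained at the left end, which forces [al] to be
    that end. A tie leaves both alternatives open, hence the large inequalities. *)
Lemma optimal_contract_threshold (al : R) : 0 < inst_rank ->
  optimal_contract I al ->
  (al = 0 /\ (1 - c) * (inst_rank + inst_unspanned) <= inst_rank) \/
  (al = ratr c /\ inst_rank <= (1 - c) * (inst_rank + inst_unspanned)).
Proof.
move=> r0 [/andP[al0 al1] [u [t [ot bt] ->] opt]].
have c0' : 0 < ratr c :> R by rewrite ltr0q.
have c1' : ratr c <= 1 :> R by rewrite -(rmorph1 ratr) ler_rat.
have := opt _ _ _ principal_value_free; rewrite lexx ler01 => /(_ isT).
have := opt _ _ _ principal_value_unspanned; rewrite (ltW c0') c1' => /(_ isT).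
rewrite principal_utilityE.
have rq0 : 0 < inst_rank + inst_unspanned by have [_ q0] := inst_ge0; rewrite ltr_wpDr.
have rq0' : 0 < ratr (inst_rank + inst_unspanned) :> R by rewrite ltr0q.
have r0' : 0 < ratr inst_rank :> R by rewrite ltr0q.
have al1' : 0 <= 1 - al by rewrite subr_ge0.
have [alc|alc] := ltP al (ratr c).
  have := ler_wpM2l al1' (agent_optimal_reward alc ot).
  move=> h1 h2 h3; left.
  have al00 : al = 0.
    apply/eqP; rewrite eq_le al0 andbT -(pmulr_lle0 _ r0').
    by have := le_trans h3 h1; rewrite mulrBl mul1r lerBrDr -lerBrDl subrr.
  split=> //; rewrite -(ler_rat R) rmorphM rmorphB rmorph1 /=.
  by apply: le_trans h2 _; apply: le_trans h1 _; rewrite al00 subr0 mul1r.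
have ft : feasible t by case: ot.
have := ler_wpM2l al1' (avg_reward_le ft).
move=> h1 h2 h3; right.
have alc' : al = ratr c.
  apply/eqP; rewrite eq_le alc andbT.
  by have := le_trans h2 h1; rewrite ler_pM2r // lerD2l lerN2.
split=> //; rewrite -(ler_rat R) rmorphM rmorphB rmorph1 /=.
by apply: le_trans h3 _; rewrite -alc'.
Qed.
End Instance.

(** * Queries *)

Section Query.
Variables (n : nat) (M : matroid 'I_n).
(* An entry [(i, c, p)] stands for a copy of [i] with cost [c] and value 1 with
   probability [p], 0 otherwise. *)
Local Notation entry := ('I_n * rat * rat)%type.
Implicit Types (es : seq entry) (l : seq ('I_n * rat)).

Definition entry_elt es : {ffun 'I_(size es) -> 'I_n} :=
  [ffun j => (tnth (in_tuple es) j).1.1].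
Definition entry_cost es : {ffun 'I_(size es) -> rat} :=
  [ffun j => (tnth (in_tuple es) j).1.2].
Definition entry_prob es (j : 'I_(size es)) : rat := (tnth (in_tuple es) j).2.
Definition entry_vals es : 'M[rat]_(size es, 2) := \matrix_(j, k) (k == ord0)%:R.
Definition entry_probs es : 'M[rat]_(size es, 2) :=
  \matrix_(j, k) if k == ord0 then entry_prob j else 1 - entry_prob j.

Definition inst es : olcpm :=
  Olcpm (parallel M (entry_elt es)) (entry_cost es) (entry_vals es) (entry_probs es).

Definition enc_entry (e : entry) : data :=
  Pair (enc_elt e.1.1) (Pair (Atom e.1.2)
    (Pair (Pair (Atom 1) (Atom e.2))
      (Pair (Pair (Atom 0) (Atom (1 - e.2))) (Atom 0)))).

Lemma map_entries (T : Type) (F : entry -> T) es :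
  [seq F (tnth (in_tuple es) j) | j <- enum 'I_(size es)] = map F es.
Proof. by rewrite (map_comp F (tnth (in_tuple es))) map_tnth_enum. Qed.

Lemma enc_inst es :
  enc_query (entry_elt es) (entry_cost es) (entry_vals es) (entry_probs es)
  = Pair (Atom 2) (data_list [seq enc_entry e | e <- es]).
Proof.
rewrite /enc_query -(map_entries enc_entry); congr (Pair _ (data_list _)).
apply: eq_map => j; rewrite /enc_entry !ffunE; congr (Pair _ (Pair _ _)).
by rewrite !enum_ordSl enum_ord0 /= !mxE.
Qed.

Lemma enc_entry_size (i : 'I_n) (c p : rat) : data_size (enc_entry (i, c, p)) =
  (rat_size i%:R + rat_size c + rat_size 1 + rat_size p + rat_size 0
   + rat_size (1 - p) + rat_size 0 + 6)%N.
Proof.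
transitivity (rat_size i%:R + (rat_size c + ((rat_size 1 + rat_size p).+1
     + ((rat_size 0 + rat_size (1 - p)).+1 + rat_size 0).+1).+1).+1).+1%N.
  by [].
lia.
Qed.

Lemma inst_valid es :
  (forall e, e \in es -> 0 <= e.1.2 /\ 0 <= e.2 <= 1) -> olcpm_valid (inst es).
Proof.
move=> h; have hj j := h _ (mem_tnth j (in_tuple es)).
split=> [j|j k|j k|j] /=; rewrite ?ffunE ?mxE.
- by case: (hj j).
- exact: ler0n.
- by have [_ /andP[p0 p1]] := hj j; case: ifP => // _; rewrite subr_ge0.
- by rewrite big_ord_recl big_ord1 !mxE /= addrCA subrr addr0.
Qed.

Lemma inst_parallel es : (forall i, exists2 e, e \in es & e.1.1 = i) ->
  is_parallel_extension M (omat (inst es)).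
Proof.
move=> h; exists (entry_elt es); split=> // i; have [e /seq_tnthP[j ->] <-] := h i.
by exists j; rewrite ffunE.
Qed.

Lemma data_list_size (s : seq data) :
  data_size (data_list s) = (\sum_(d <- s) (data_size d).+1 + 4)%N.
Proof.
elim: s => [|d s IH]; first by rewrite big_nil /= rat_size0.
by rewrite big_cons /= IH; lia.
Qed.

(** The encoding contains every number of the instance, so that the cost of writing down a query
    bounds its size. *)
Lemma inst_size es :
  (olcpm_size (inst es)
   <= data_size (Pair (Atom 2) (data_list [seq enc_entry e | e <- es])))%N.
Proof.
rewrite [data_size _]/= data_list_size big_map big_tnth.
have -> : olcpm_size (inst es) = (\sum_(j < size es) (1 + rat_size (entry_cost es j)
    + \sum_k (rat_size (entry_vals es j k) + rat_size (entry_probs es j k))) + 2)%N.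
  by rewrite /olcpm_size /= !big_split /= sum1_card card_ord; lia.
have := rat_size_ge4 2.
suff : (\sum_(j < size es) (1 + rat_size (entry_cost es j)
    + \sum_k (rat_size (entry_vals es j k) + rat_size (entry_probs es j k)))
  <= \sum_(j < size es) (data_size (enc_entry (tnth (in_tuple es) j))).+1)%N by lia.
apply: leq_sum => j _; rewrite !big_ord_recl big_ord0 !mxE ffunE /entry_prob.
move: (tnth _ j) => [[i c] p].
change ((1 + rat_size c + (rat_size 1 + rat_size p + (rat_size 0 + rat_size (1 - p) + 0))
  <= (data_size (enc_entry (i, c, p))).+1)%N).
rewrite enc_entry_size; lia.
Qed.

(** * The instance submitted for a given target and threshold *)

Section Target.
Variables (l : seq ('I_n * rat)) (a : 'I_n) (c : rat).

Definition target_entries : seq entry :=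
  (a, c, 1) :: [seq (x.1, 0, x.2) | x <- l].
Local Notation es := target_entries.
Local Notation J := 'I_(size es).
Let a' : J := ord0.

(** With two outcomes per copy, a profile amounts to the set of copies of value 1. The sum over
    profiles thus becomes an expectation over sets of copies, which is carried over to the original
    elements. *)
Lemma inst_sum (G : {set 'I_n} -> rat) :
  \sum_(x : profile (inst es)) profile_prob x * G (entry_elt es @: (ones x :\ a'))
  = Ex l G.
Proof.
pose prof (T : {set J}) : profile (inst es) := [ffun j => if j \in T then ord0 else ord_max].
pose outs (x : profile (inst es)) : {set J} := [set j | x j == ord0].
have profK x : prof (outs x) = x.
  apply/ffunP => j; rewrite ffunE inE; case: eqP => [->//|].
  by case: (x j) => -[|[|k]] //= k2 h; apply/val_inj => //; case: h; apply/val_inj.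
have ones_prof (T : {set J}) : ones (prof T) = T.
  apply/setP => j; rewrite inE /profile_val mxE ffunE.
  by case: (j \in T).
rewrite (reindex_onto prof outs) /=; last by move=> x _; exact: profK.
pose p (j : J) : rat := entry_prob j.
have eT : [set i in enum J] = setT by apply/setP => j; rewrite !inE mem_enum.
transitivity (Ex [seq (j, p j) | j <- enum J]
    (fun T => G (entry_elt es @: (T :\ a')))).
  rewrite -Ex_sum ?enum_uniq //; apply: eq_big => T.
    rewrite eT subsetT; apply/eqP/setP => j; rewrite inE ffunE.
    by case: (j \in T).
  move=> _; rewrite ones_prof; congr (_ * _).
  rewrite /profile_prob (bigID (mem T)) /=; congr (_ * _).
    by apply: eq_bigr => j jT; rewrite mxE ffunE jT.
  rewrite eT; apply: eq_big => j; first by rewrite !inE andbT.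
  by move=> jT; rewrite mxE ffunE (negPf jT).
pose l' : seq entry := [seq (x.1, 0, x.2) | x <- l].
have eJ : enum J = a' :: [seq lift ord0 i | i <- enum 'I_(size l')] := enum_ordSl _.
have h := congr1 behead (map_entries (fun e => (e.1.1, e.2)) es).
rewrite eJ in h *; rewrite map_cons [Ex _ _]/=.
(* The target copy has probability 1: only the branch inserting [a'] survives, and removing [a']
   undoes the insertion. *)
have -> : p a' = 1 by rewrite /p /entry_prob (tnth_nth (a, c, 1)).
rewrite subrr mul0r addr0 mul1r.
transitivity (Ex [seq (j, p j) | j <- [seq lift ord0 i | i <- enum 'I_(size l')]]
    (fun A : {set J} => G (entry_elt es @: A))).
  apply: Ex_eq_in => A sA; rewrite setU1K //.
  apply: contraT => /negPn /(subsetP sA); rewrite inE -!map_comp => /mapP[j _] /eqP.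
  by rewrite -val_eqE.
rewrite Ex_imset; congr (Ex _ G).
transitivity [seq (x.1.1, x.2) | x <- l'].
  by rewrite -[RHS]h map_cons [behead _]/= -!map_comp; apply: eq_map => j /=; rewrite ffunE.
by rewrite -map_comp -[RHS]map_id; apply: eq_map => -[].
Qed.

Lemma inst_rankE : inst_rank (a' : 'I_(oN (inst es))) = exp_rank M l.
Proof.
rewrite /exp_rank -inst_sum; apply: eq_bigr => x _.
by rewrite /= rank_parallel.
Qed.

Lemma inst_unspannedE :
  inst_unspanned (a' : 'I_(oN (inst es))) = prob_unspanned M a l.
Proof.
rewrite /prob_unspanned -inst_sum; apply: eq_bigr => x _.
by rewrite /unspanned /= !rank_parallel imsetU1 ffunE (tnth_nth (a, c, 1)).
Qed.

(** The contract is optimal among reals, but the answer and the two candidates are rational, and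
    [ratr] is injective. *)
Lemma oracle_threshold (R : realType) (O : olcpm -> rat) :
  solves_olcpm R O -> probs l -> 0 < c -> c <= 1 -> 0 < exp_rank M l ->
  (O (inst es) = 0 /\
     (1 - c) * (exp_rank M l + prob_unspanned M a l) <= exp_rank M l) \/
  (O (inst es) = c /\
     exp_rank M l <= (1 - c) * (exp_rank M l + prob_unspanned M a l)).
Proof.
move=> hO hl c0 c1; rewrite -inst_rankE -inst_unspannedE => r0.
have vI : olcpm_valid (inst es).
  apply: inst_valid => e; rewrite inE => /predU1P[->|] /=.
    by rewrite ltW ?ler01 ?lexx.
  by move=> /mapP[x /hl xp ->] /=.
have costI (j : 'I_(oN (inst es))) : ocost (inst es) j = if j == a' then c else 0.
  rewrite /= ffunE; case: eqP => [->|]; first by rewrite (tnth_nth (a, c, 1)).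
  case: j => -[|j] hj /= ja; first by case: ja; apply: val_inj.
  rewrite (tnth_nth (a, c, 1)) /=.
  by have /mapP[x _ ->] := @mem_nth _ (a, c, 1) [seq (x.1, 0, x.2) | x <- l] j hj.
have val01 (j : 'I_(oN (inst es))) k : (oval (inst es) j k == 0) || (oval (inst es) j k == 1).
  by rewrite mxE; case: (k == _); rewrite eqxx ?orbT.
have val_a k : oprob (inst es) a' k != 0 -> oval (inst es) a' k = 1.
  rewrite /= !mxE; case: (k == _) => //.
have [[h1 h2]|[h1 h2]] :=
  optimal_contract_threshold vI val01 costI val_a c0 c1 r0 (hO _ vI).
  left; split=> //; apply: (fmorph_inj (@ratr R)).
  exact: etrans h1 (esym (rmorph0 _)).
by right; split=> //; apply: (fmorph_inj (@ratr R)).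
Qed.
End Target.
End Query.

(** * The program *)

(* Registers: 0 input and output, 1 remaining list of probabilities, 2 index of
   its head, 3 free entries of the queries, 4 delta (an inverse integer of which
   all the probabilities involved are multiples), 5-7 operands of the gcd,
   8 a power of two times delta exceeding 1, 9 expected rank, 10 lower bound and
   result of the binary search, 11 its width, 12 threshold, 13 cost of the
   target, 14 contract chosen by the oracle, 15 target element. *)

Definition entry_expr (i c p : expr) : expr :=
  ECons i (ECons c (ECons (ECons (EConst 1) p)
    (ECons (ECons (EConst 0) (ESub (EConst 1) p)) (EConst 0)))).

(* Subtractive Euclid on registers 4 and 5, the subtrahend (register 6) being
   doubled as long as possible to make the number of steps polynomial. *)
Definition gcd_com : com :=
  CWhile (EVar 5)
    (CIf (ELeq (EAdd (EVar 6) (EVar 6)) (EVar 4))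
       (CAssign 6 (EAdd (EVar 6) (EVar 6)))
       (CSeq (CAssign 7 (ESub (EVar 4) (EVar 6)))
          (CIf (ELeq (EVar 5) (EVar 7))
             (CSeq (CAssign 4 (EVar 7)) (CAssign 6 (EVar 5)))
             (CSeq (CAssign 4 (EVar 5))
                (CSeq (CAssign 5 (EVar 7)) (CAssign 6 (EVar 7))))))).

Definition advance_com : com :=
  CSeq (CAssign 1 (ESnd (EVar 1))) (CAssign 2 (EAdd (EVar 2) (EConst 1))).

(** Each element receives a dummy copy of probability 0, so that every later query is a parallel
    extension in which all elements survive. The gcd then divides register 4 by the denominator of
    the current probability. *)
Definition prepare_body : com :=
  CSeq (CAssign 3 (ECons (entry_expr (EVar 2) (EConst 0) (EConst 0)) (EVar 3)))
  (CSeq (CAssign 5 (EMul (EFst (EVar 1)) (EVar 4)))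
  (CSeq (CAssign 6 (EVar 5))
  (CSeq gcd_com advance_com))).

Definition prepare_com : com :=
  CSeq (CAssign 1 (ESnd (EVar 0)))
  (CSeq (CAssign 2 (EConst 0))
  (CSeq (CAssign 3 (EConst 0))
  (CSeq (CAssign 4 (EConst 1))
  (CSeq (CWhile (EIsPair (EVar 1)) prepare_body)
  (CSeq (CAssign 8 (EVar 4))
     (CWhile (ELeq (EVar 8) (EConst 1)) (CAssign 8 (EAdd (EVar 8) (EVar 8))))))))).

Definition query_expr : expr :=
  ECons (EConst 2) (ECons (entry_expr (EVar 15) (EVar 13) (EConst 1)) (EVar 3)).

(** The oracle answers 0 or the cost in register 13; the quotient of the two is the bit that tells
    which half to keep. *)
Definition search_body : com :=
  CSeq (CAssign 11 (EDiv (EVar 11) (EConst 2)))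
  (CSeq (CAssign 12 (ESub (EAdd (EVar 10) (EVar 11)) (EDiv (EVar 4) (EConst 2))))
  (CSeq (CAssign 13 (EDiv (EVar 12) (EAdd (EVar 9) (EVar 12))))
  (CSeq (CAskOlcpm 14 query_expr)
     (CAssign 10 (EAdd (EVar 10) (EMul (EDiv (EVar 14) (EVar 13)) (EVar 11))))))).

Definition solve_com : com :=
  CIf (EVar 9)
    (CSeq (CAssign 10 (EConst 0))
    (CSeq (CAssign 11 (EVar 8))
       (CWhile (ESub (EVar 11) (EVar 4)) search_body)))
    (CAskIndep 10 (ECons (EVar 15) (EConst 0))).

Definition rank_body : com :=
  CSeq (CAssign 15 (EVar 2))
  (CSeq solve_com
  (CSeq (CAssign 9 (EAdd (EVar 9) (EMul (EFst (EVar 1)) (EVar 10))))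
  (CSeq (CAssign 3 (ECons (entry_expr (EVar 2) (EConst 0) (EFst (EVar 1))) (EVar 3)))
     advance_com))).

(** The input gives probability 0 to the distinguished element, so the random set of the final
    search avoids it. *)
Definition upm_com : com :=
  CSeq prepare_com
  (CSeq (CAssign 1 (ESnd (EVar 0)))
  (CSeq (CAssign 2 (EConst 0))
  (CSeq (CAssign 9 (EConst 0))
  (CSeq (CWhile (EIsPair (EVar 1)) rank_body)
  (CSeq (CAssign 15 (EFst (EVar 0)))
  (CSeq solve_com
     (CAssign 0 (EVar 10)))))))).

(** * Frame conditions and the gcd loop *)

Lemma natr_bool_neq0 (b : bool) : (b%:R != 0 :> rat) = b.
Proof. by case: b. Qed.

Definition agree_off (rs : seq nat) (s s' : store) : Prop :=
  forall r, r \notin rs -> s' r = s r.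

Lemma agree_off_upd rs s s' x d :
  x \in rs -> agree_off rs s s' -> agree_off rs s (upd s' x d).
Proof.
move=> xrs h r nr; rewrite /upd; case: eqP => [rx|_]; last exact: h.
by rewrite -rx (negPf nr) in xrs.
Qed.

(** A lexicographic order in one number: a subtraction halves the product [X * Y], while a doubling
    keeps it and raises the logarithm of [Z], which is at most [L]. *)
Definition gcd_measure (L X Y Z : nat) : nat :=
  if Y == 0%N then 0%N
  else (L.+1 * trunc_log 2 (X * Y) + (L - trunc_log 2 Z)).+1.

Lemma gcd_measure_double (L X Y Z : nat) : (0 < Z)%N -> (0 < Y)%N ->
  (Z + Z <= X)%N -> (X < 2 ^ L.+1)%N ->
  (gcd_measure L X Y (Z + Z) < gcd_measure L X Y Z)%N.
Proof.
move=> Z0 Y0 ZX XL; rewrite /gcd_measure (gtn_eqF Y0) addnn.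
have : (trunc_log 2 Z.*2 <= L)%N.
  rewrite -ltnS -(@ltn_exp2l 2) //; apply: leq_ltn_trans (trunc_logP _ _) _ => //.
    by rewrite double_gt0.
  by rewrite -addnn; apply: leq_ltn_trans XL.
rewrite trunc_log2_double //; lia.
Qed.

Lemma gcd_measure_sub (L X Y Z X' Y' Z' : nat) : (0 < Y)%N -> (0 < X)%N ->
  ((X' * Y').*2 <= X * Y)%N -> (0 < X')%N ->
  (gcd_measure L X' Y' Z' < gcd_measure L X Y Z)%N.
Proof.
move=> Y0 X0 h X'0; rewrite /gcd_measure (gtn_eqF Y0).
have [//|Y'0] := posnP Y'.
have := leq_trunc_log 2 h; rewrite trunc_log2_double ?muln_gt0 ?X'0 //.
move: (trunc_log 2 (X' * Y')) (trunc_log 2 (X * Y)) => t t' tt'.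
rewrite ltnS; apply: leq_trans (_ : L.+1 * t.+1 <= _)%N.
  by rewrite mulnS; lia.
by apply: leq_trans (leq_addr _ _); rewrite leq_mul2l tt' orbT.
Qed.

Lemma gcd_measure_le (L X Y Z : nat) : (X < 2 ^ L.+1)%N -> (Y <= X)%N ->
  (gcd_measure L X Y Z <= L.+1 * (L.*2.+3) + L.+1)%N.
Proof.
move=> XL YX; rewrite /gcd_measure; case: eqP => [//|/eqP]; rewrite -lt0n => Y0.
have : (trunc_log 2 (X * Y) <= L.*2.+2)%N.
  rewrite -ltnS -(@ltn_exp2l 2) //; apply: leq_ltn_trans (trunc_logP _ _) _ => //.
    by rewrite muln_gt0 Y0 andbT; apply: leq_trans YX.
  apply: leq_ltn_trans (leq_mul (ltnW XL) (leq_trans YX (ltnW XL))) _.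
  by rewrite -expnD ltn_exp2l //; lia.
move=> h; rewrite -addSn; apply: leq_add; last by lia.
have := leq_mul (leqnn L.+1) h; rewrite !mulnS; lia.
Qed.

Lemma rat_size_nat_frac (m X Y : nat) : (X < 2 ^ m.+1)%N -> (0 < Y)%N ->
  (Y < 2 ^ m.+1)%N -> (rat_size (X%:R * Y%:R^-1) <= 2 * m + 4)%N.
Proof.
move=> Xm Y0 Ym; rewrite mul2n -addnn.
apply: (@rat_size_frac _ X%:Z Y%:Z) => //; last by rewrite eqz_nat -lt0n.
by rewrite -!pmulrn mulfVK // pnatr_eq0 -lt0n.
Qed.

Section Correct.
Variables (n : nat) (M : matroid 'I_n) (O : olcpm -> rat).
Variables (I B m : nat) (good : olcpm -> Prop).
Hypothesis mI : (m.+1 * (m.*2.+3) + m.+1 <= I)%N.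
Hypothesis mB : (2 * m + 4 <= B)%N.
Local Notation wp := (wp M O I B good).

(** In units of [u], registers 4 and 5 start at the denominator and the numerator of [p]. These are
    coprime, so the loop ends with [u] itself. *)
Lemma wp_gcd (s : store) (D : nat) (p : rat) : 0 <= p <= 1 ->
  (0 < D)%N -> (D * `|denq p| < 2 ^ m.+1)%N ->
  s 4 = Atom D%:R^-1 -> s 5 = Atom (p * D%:R^-1) -> s 6 = Atom (p * D%:R^-1) ->
  wp gcd_com s (fun s' => agree_off [:: 4; 5; 6; 7] s s' /\
    s' 4 = Atom (D * `|denq p|)%:R^-1).
Proof.
move=> /andP[p0 p1] D0; set b := `|denq p|%N => Dbm s4 s5 s6.
pose a := `|numq p|%N; pose u : rat := (D * b)%:R^-1.
have b0 : (0 < b)%N by rewrite absz_gt0 denq_neq0.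
have Db0 : (0 < D * b)%N by rewrite muln_gt0 D0.
have u0 : 0 < u by rewrite invr_gt0 ltr0n.
have Du : D%:R^-1 = b%:R * u.
  by rewrite /u natrM invfM mulrCA divff ?mulr1 // pnatr_eq0 -lt0n.
have pb : p * b%:R = a%:R.
  rewrite /a /b pmulrn [X in X%:~R]absz_denq -numqE pmulrn gez0_abs //.
  by rewrite numq_ge0.
have pu : p * D%:R^-1 = a%:R * u by rewrite Du mulrA pb.
have ab : (a <= b)%N by rewrite -(ler_nat rat) -pb ger_pMl // ltr0n.
have bm : (b < 2 ^ m.+1)%N by apply: leq_ltn_trans Dbm; rewrite leq_pmull.
have szX (X : nat) : (X <= b)%N -> (data_size (Atom (X%:R * u)) <= B)%N.
  move=> Xb; apply: leq_trans mB; apply: rat_size_nat_frac => //.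
  exact: leq_ltn_trans bm.
pose J k s' := agree_off [:: 4; 5; 6; 7] s s' /\ exists X Y Z : nat,
  [/\ s' 4 = Atom (X%:R * u), s' 5 = Atom (Y%:R * u), s' 6 = Atom (Z%:R * u)
    & [/\ coprime X Y, (0 < X <= b)%N, (Y <= X)%N,
          (0 < Y -> [/\ Y %| Z, 0 < Z & Z <= X])%N & (gcd_measure m X Y Z <= k)%N]].
apply: (@wp_while _ _ _ _ _ _ _ _ J (gcd_measure m b a a)).
- split; first by [].
  exists b, a, a; rewrite s4 s5 s6 pu Du; split=> //.
  by rewrite leqnn b0 coprime_sym; split=> //; exact: coprime_num_den.
- by apply: leq_trans mI; apply: gcd_measure_le.
- move=> k s1 [fr [X [Y [Z [e4 e5 e6 [cXY /andP[X0 Xb] YX hY hk]]]]]].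
  rewrite [eval _ _]/= e5 /truth mulf_eq0 (gt_eqF u0) orbF pnatr_eq0 -lt0n => Y0.
  have [YZ Z0 ZX] := hY Y0.
  apply: wp_if; rewrite /= e6 e4 /= -mulrDl ler_pM2r // -natrD ler_nat natr_bool_neq0.
  case: ifP => [ZZX|/negbT]; [|rewrite -ltnNge => XZZ].
    apply: wp_assign; rewrite /= e6 /= -mulrDl -natrD.
      by move=> _; apply: szX; apply: leq_trans Xb.
    exists (gcd_measure m X Y (Z + Z)).
      apply: leq_trans hk; apply: gcd_measure_double => //.
      exact: leq_ltn_trans bm.
    split; first exact: agree_off_upd.
    exists X, Y, (Z + Z)%N; rewrite /upd /=; split=> //; split=> //; first by rewrite X0.
    by move=> _; rewrite dvdn_add // addn_gt0 Z0.
  have eW : X%:R * u - Z%:R * u = (X - Z)%:R * u by rewrite -mulrBl natrB.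
  have YZle : (Y <= Z)%N by apply: dvdn_leq.
  have cYW : coprime Y (X - Z).
    (* As [Y] divides [Z], subtracting [Z] from [X] preserves the gcd with [Y]. *)
    move: cXY; rewrite coprime_sym /coprime -{1}(subnKC ZX).
    by have /dvdnP[j ->] := YZ; rewrite gcdnMDl.
  apply: wp_seq; apply: wp_assign; rewrite /= e6 e4 /= eW.
    by move=> _; apply: szX; apply: leq_trans (leq_subr _ _) Xb.
  (* [Z] can no longer be doubled within [X], so [X - Z] is less than half of [X]. *)
  have hW : ((Y * (X - Z)).*2 <= X * Y)%N.
    rewrite -muln2 -mulnA mulnC leq_mul2r; apply/orP; right; lia.
  apply: wp_if; rewrite /upd /= e5 /= ler_pM2r // ler_nat natr_bool_neq0.
  case: ifP => [YW|/negbT]; [|rewrite -ltnNge => WY].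
    apply: wp_seq; apply: wp_assign => /=.
      by move=> _; apply: szX; apply: leq_trans (leq_subr _ _) Xb.
    apply: wp_assign; rewrite /= /upd /= e5.
      by move=> _; apply: szX; apply: leq_trans Xb.
    exists (gcd_measure m (X - Z) Y Y).
      apply: leq_trans hk; apply: gcd_measure_sub => //; first by rewrite mulnC.
      exact: leq_trans YW.
    split; first by do 3 (apply: agree_off_upd => //).
    exists (X - Z)%N, Y, Y; split=> //; split; rewrite 1?coprime_sym ?dvdnn //.
    by rewrite (leq_trans Y0 YW) (leq_trans (leq_subr _ _) Xb).
  apply: wp_seq; apply: wp_assign; rewrite /= /upd /= e5.
    by move=> _; apply: szX; apply: leq_trans Xb.
  apply: wp_seq; apply: wp_assign => /=.
    by move=> _; apply: szX; apply: leq_trans (leq_subr _ _) Xb.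
  apply: wp_assign; rewrite /= /upd /=.
    by move=> _; apply: szX; apply: leq_trans (leq_subr _ _) Xb.
  exists (gcd_measure m Y (X - Z) (X - Z)).
    by apply: leq_trans hk; apply: gcd_measure_sub.
  split; first by do 4 (apply: agree_off_upd => //).
  exists Y, (X - Z)%N, (X - Z)%N; split=> //; split; rewrite ?Y0 ?(leq_trans YX Xb) //.
    exact: ltnW.
  by rewrite dvdnn => ->; rewrite ltnW.
move=> k s1 [fr [X [Y [Z [e4 e5 e6 [cXY /andP[X0 Xb] YX hY hk]]]]]].
rewrite [eval _ _]/= e5 /truth mulf_eq0 (gt_eqF u0) orbF pnatr_eq0 negbK => /eqP Y0.
(* On exit [Y] is 0, and coprimality makes [X] equal to 1. *)
split=> //; rewrite e4; move: cXY; rewrite Y0 /coprime gcdn0 => /eqP ->.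
by rewrite mul1r.
Qed.
End Correct.

Lemma enum_ord_split (n : nat) (s1 s2 : seq 'I_n) (i : 'I_n) :
  enum 'I_n = s1 ++ i :: s2 -> i = size s1 :> nat.
Proof.
move=> h; have := congr1 (fun s => nth 0%N (map val s) (size s1)) h.
rewrite val_enum_ord map_cat nth_cat !size_map ltnn subnn /= nth_iota //.
by have := congr1 size h; rewrite size_enum_ord size_cat /=; lia.
Qed.

(** * Size bounds and correctness of the binary search *)

Section Solve.
Variables (n : nat) (M : matroid 'I_n) (R : realType) (O : olcpm -> rat).
Hypothesis solO : solves_olcpm R O.
Variables (sigma : nat) (p : 'I_n -> rat).
Hypothesis n_le : (n <= sigma)%N.
Hypothesis p01 : forall i, 0 <= p i <= 1.
Hypothesis p_size : forall i, (rat_size (p i) <= sigma + 4)%N.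

Definition common_denom (s : seq 'I_n) : nat := \prod_(i <- s) `|denq (p i)|%N.
Local Notation d := (common_denom (enum 'I_n)).
Hypothesis d_le : (d <= 2 ^ sigma)%N.

(** Enough for terms of fractions up to [12 * d + 4 * (sigma * d)], as [sigma] and [d] are at most
    [2 ^ sigma]. *)
Definition num_bits : nat := (2 * sigma + 6)%N.
(** The bound of [gcd_measure_le] at [num_bits]; the other loops make at most [sigma.+2]
    iterations. *)
Definition iter_bound : nat := (num_bits.+1 * num_bits.*2.+3 + num_bits.+1)%N.
(** Room for [2 * n] entries of register 3, each charged [10 * sigma + 101], with one such block to
    spare. *)
Definition reg_bound : nat := ((2 * sigma).+1 * (10 * sigma + 101))%N.
Definition good_query (I : olcpm) : Prop :=
  [/\ olcpm_valid I, is_parallel_extension M (omat I)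
    & (olcpm_size I <= expr_factor query_expr * reg_bound.+1)%N].
Local Notation wp := (wp M O iter_bound reg_bound good_query).

Definition free_copies (q : 'I_n -> rat) (s : seq 'I_n) : seq ('I_n * rat) :=
  [seq (i, q i) | i <- rev s].
Definition enc_free (l : seq ('I_n * rat)) : data :=
  data_list [seq enc_entry (x.1, 0, x.2) | x <- l].

Lemma common_denom_cat s1 s2 :
  common_denom (s1 ++ s2) = (common_denom s1 * common_denom s2)%N.
Proof. by rewrite /common_denom big_cat. Qed.

Lemma common_denom_gt0 s : (0 < common_denom s)%N.
Proof. by apply: prodn_gt0 => i; rewrite absz_gt0 denq_neq0. Qed.

Lemma reg_bound_num : (2 * num_bits + 4 <= reg_bound)%N.
Proof. by rewrite /reg_bound mulSn /num_bits; lia. Qed.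

Lemma num_lt (X : nat) :
  (X <= 12 * d + 4 * (sigma * d))%N -> (X < 2 ^ num_bits.+1)%N.
Proof.
move=> hX; apply: leq_ltn_trans hX _.
have h1 : (sigma * d <= 2 ^ sigma * 2 ^ sigma)%N.
  by apply: leq_mul d_le; rewrite ltnW // ltn_expl.
have h2 : (d <= 2 ^ sigma * 2 ^ sigma)%N.
  by apply: leq_trans d_le _; rewrite leq_pmull // expn_gt0.
have -> : (2 ^ num_bits.+1 = 128 * (2 ^ sigma * 2 ^ sigma))%N.
  rewrite -expnD -[128%N]/(2 ^ 7)%N -expnD; congr (2 ^ _)%N; rewrite /num_bits; lia.
have : (0 < 2 ^ sigma * 2 ^ sigma)%N by rewrite muln_gt0 expn_gt0.
lia.
Qed.

Lemma frac_size (X Y : nat) : (X < 2 ^ num_bits.+1)%N -> (0 < Y)%N ->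
  (Y < 2 ^ num_bits.+1)%N -> (rat_size (X%:R * Y%:R^-1) <= reg_bound)%N.
Proof.
by move=> *; apply: leq_trans reg_bound_num; apply: rat_size_nat_frac.
Qed.

Lemma nat_size (X : nat) : (X <= sigma)%N -> (rat_size X%:R <= 2 * sigma + 4)%N.
Proof.
move=> Xs; rewrite -[X%:R]mulr1 -invr1; apply: (@rat_size_nat_frac _ X 1) => //.
  apply: leq_ltn_trans Xs _; apply: leq_trans (ltn_expl sigma (isT : 1 < 2)%N) _.
  by rewrite leq_exp2l.
by rewrite -[1%N](expn0 2) ltn_exp2l.
Qed.

Lemma enc_free_size (l : seq ('I_n * rat)) : (size l <= 2 * n)%N ->
  (forall x, x \in l -> (rat_size x.2 <= sigma + 4)%N) ->
  (data_size (enc_free l) <= reg_bound)%N.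
Proof.
move=> sl hl; rewrite data_list_size big_map.
apply: leq_trans (_ : size l * (10 * sigma + 101) + 4 <= _)%N.
  rewrite leq_add2r mulnC -iter_addn_0 -count_predT -big_const_seq !big_seq.
  apply: leq_sum => x xl.
  have h1 : (rat_size 1 <= 6)%N := rat_size_bool true.
  have h2 := nat_size (leq_trans (ltnW (ltn_ord x.1)) n_le).
  have h3 := hl _ xl; have h4 := rat_sizeB 1 x.2.
  rewrite enc_entry_size rat_size0.
  move: h1 h2 h3 h4.
  move: (rat_size 1) (rat_size x.1%:R) (rat_size x.2) (rat_size (1 - x.2)).
  by move=> *; lia.
rewrite /reg_bound [((2 * sigma).+1 * _)%N]mulSn addnC leq_add //; first by lia.
by rewrite leq_mul2r (leq_trans sl) ?orbT // leq_mul2l.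
Qed.

Lemma probs_size (s : seq 'I_n) :
  (data_size (data_list [seq Atom (p i) | i <- s]) <= size s * (sigma + 5) + 4)%N.
Proof.
rewrite data_list_size big_map leq_add2r mulnC -iter_addn_0 -count_predT -big_const_seq.
by apply: leq_sum => i _ /=; have := p_size i; lia.
Qed.

(** The search maintains [lo <= N < lo + 2 ^ k] for the unknown numerator [N] over [d]. Every
    element occurs in [l], as parallel extensions require. *)
Lemma wp_solve s l a r N K : probs l -> (forall i, i \in map fst l) ->
  exp_rank M l = r%:R * d%:R^-1 -> (r <= 2 * sigma * d)%N ->
  prob_unspanned M a l = N%:R * d%:R^-1 ->
  s 3 = enc_free l -> s 4 = Atom d%:R^-1 -> s 8 = Atom ((2 ^ K)%:R * d%:R^-1) ->
  (d < 2 ^ K <= 2 * d)%N -> s 9 = Atom (exp_rank M l) -> s 15 = enc_elt a ->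
  wp solve_com s (fun s' => agree_off [:: 10; 11; 12; 13; 14] s s' /\
    s' 10 = Atom (prob_unspanned M a l)).
Proof.
move=> hl hs er rle eN s3 s4 s8 /andP[dK Kd] s9 s15.
have d0 : (0 < d)%N := common_denom_gt0 _.
have d0r : 0 < d%:R :> rat by rewrite ltr0n.
have sz4 : (4 <= reg_bound)%N by apply: leq_trans reg_bound_num; lia.
have sz6 : (6 <= reg_bound)%N by apply: leq_trans reg_bound_num; rewrite /num_bits; lia.
apply: wp_if; rewrite [eval _ _]/= s9 /truth.
case: ifP => [R0|/negbFE/eqP R0]; last first.
  apply: (@wp_ask_indep _ _ _ _ _ _ _ _ _ [:: a]) => //; first by rewrite /= s15.
  split; first exact: agree_off_upd.
  rewrite /upd /= (prob_unspanned_rank0 _ hl R0).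
  suff -> : [set a] = [set i in [:: a]] by [].
  by apply/setP => i; rewrite !inE.
have r0 : (0 < r)%N.
  by rewrite lt0n; apply: contra R0 => /eqP r0; rewrite er r0 mul0r.
have Nd : (N <= d)%N.
  have /andP[_] := prob_unspanned_bounds M a hl.
  by rewrite eN ler_pdivrMr // mul1r ler_nat.
have dm := num_lt.
pose J k s' := agree_off [:: 10; 11; 12; 13; 14] s s' /\ (k <= K)%N /\
  exists lo : nat, [/\ s' 10 = Atom (lo%:R * d%:R^-1),
    s' 11 = Atom ((2 ^ k)%:R * d%:R^-1) & (lo <= N < lo + 2 ^ k)%N].
have Kbits : (K <= iter_bound)%N.
  have : (2 ^ K <= 2 ^ sigma.+1)%N by apply: leq_trans Kd _; rewrite expnS leq_mul2l.
  rewrite leq_exp2l // => h; apply: leq_trans h _.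
  by rewrite /iter_bound mulSn /num_bits; lia.
apply: wp_seq; apply: wp_assign; rewrite /= ?rat_size0 //.
apply: wp_seq; apply: wp_assign; rewrite /= /upd /= s8.
  by move=> _; apply: frac_size => //; apply: dm; lia.
apply: (@wp_while _ _ _ _ _ _ _ _ J K) => //.
- split; first by do 2 (apply: agree_off_upd => //).
  split=> //; exists 0%N; rewrite /= mul0r; split=> //=.
  exact: leq_ltn_trans Nd dK.
- move=> k s1 [fr [kK [lo [e10 e11 /andP[loN Nlo]]]]].
  have e4 : s1 4 = Atom d%:R^-1 by rewrite fr.
  have e9 : s1 9 = Atom (exp_rank M l) by rewrite fr.
  have e15 : s1 15 = enc_elt a by rewrite fr.
  have e3 : s1 3 = enc_free l by rewrite fr.
  rewrite /= e11 e4 /=.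
  case: k kK e11 Nlo => [|k] kK e11 Nlo; first by rewrite expn0 mul1r subrr eqxx.
  move=> _; have k2 : (2 ^ k.+1 = 2 * 2 ^ k)%N by rewrite expnS.
  have k0 : (0 < 2 ^ k)%N by rewrite expn_gt0.
  have kd : (2 ^ k <= d)%N.
    by rewrite -(@leq_pmul2l 2) // -k2; apply: leq_trans Kd; rewrite leq_exp2l.
  have eW : (2 ^ k.+1)%:R * d%:R^-1 / 2 = (2 ^ k)%:R * d%:R^-1 :> rat.
    by rewrite k2 natrM; field; rewrite gt_eqF.
  apply: wp_seq; apply: wp_assign; rewrite /= e11 /= eW.
    by move=> _; apply: frac_size => //; apply: dm; lia.
  (* The threshold is [T / (2 * d)], halfway between the multiples [lo + 2 ^ k - 1] and [lo + 2 ^ k]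
     of [1 / d]. As [T] is odd, it differs from [2 * N]: no tie occurs and the answer is
     conclusive. *)
  pose T := (2 * (lo + 2 ^ k)).-1.
  have T0 : (0 < T)%N by rewrite /T; lia.
  have Tr : T%:R = 2 * (lo%:R + (2 ^ k)%:R) - 1 :> rat.
    by rewrite -natrD -natrM /T -subn1 natrB //; lia.
  have et : lo%:R * d%:R^-1 + (2 ^ k)%:R * d%:R^-1 - d%:R^-1 / 2
      = T%:R * (2 * d)%:R^-1 :> rat.
    by rewrite Tr natrM; field; rewrite gt_eqF.
  apply: wp_seq; apply: wp_assign; rewrite /= /upd /= e10 e4 /= et.
    by move=> _; apply: frac_size; rewrite ?muln_gt0 //; apply: dm; rewrite /T; lia.
  pose c : rat := T%:R * (2 * r + T)%:R^-1.
  have ec : T%:R * (2 * d)%:R^-1 / (exp_rank M l + T%:R * (2 * d)%:R^-1) = c.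
    rewrite er /c natrM natrD natrM; field.
    by rewrite !gt_eqF // -?natrM -?natrD ltr0n; lia.
  apply: wp_seq; apply: wp_assign; rewrite /= /upd /= e9 /= ec.
    by move=> _; apply: frac_size; rewrite ?addn_gt0 ?T0 ?orbT //; apply: dm; rewrite /T; lia.
  have rT0 : 0 < (2 * r + T)%:R :> rat by rewrite ltr0n; lia.
  have erT : (2 * r + T)%:R = 2 * r%:R + T%:R :> rat by rewrite natrD natrM.
  have c0 : 0 < c by rewrite divr_gt0 // ltr0n.
  have c1 : c <= 1 by rewrite ler_pdivrMr // mul1r ler_nat leq_addl.
  have eR0 : 0 < exp_rank M l by rewrite er divr_gt0 // ltr0n.
  pose es := target_entries l a c.
  have sc : (rat_size c <= reg_bound)%N.
    by apply: frac_size; rewrite ?addn_gt0 ?T0 ?orbT //; apply: dm; rewrite /T; lia.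
  have ans := @oracle_threshold n M l a c R O solO hl c0 c1 eR0.
  have evq s2 : s2 15 = enc_elt a -> s2 13 = Atom c -> s2 3 = enc_free l ->
      eval s2 query_expr = Pair (Atom 2) (data_list [seq enc_entry e | e <- es]).
    by move=> h1 h2 h3; rewrite [eval _ _]/= h1 h2 h3 /enc_free /= -map_comp.
  apply: wp_seq.
  apply: (@wp_ask_olcpm _ _ _ _ _ _ _ _ _ _ _ (entry_elt es) (entry_cost es)
    (entry_vals es) (entry_probs es)).
  + by rewrite enc_inst evq //= ?e15 ?e3.
  + rewrite evq; try by rewrite /= ?e15 ?e3.
    move=> szq; split; last exact: leq_trans (inst_size _ _) szq.
    * apply: inst_valid => e; rewrite inE => /predU1P[->|] /=.
        by rewrite ltW ?ler01 ?lexx.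
      by move=> /mapP[x /hl xp ->] /=.
    * apply: inst_parallel => i; have /mapP[x xl ->] := hs i.
      exists (x.1, 0, x.2) => //; rewrite inE; apply/orP; right.
      by apply/mapP; exists x.
  + by case: ans => -[-> _] //; rewrite rat_size0.
  set x := O _.
  have [N' [hN' hx]] : exists N' : nat, (N' <= N < N' + 2 ^ k)%N /\
      lo%:R * d%:R^-1 + x / c * ((2 ^ k)%:R * d%:R^-1) = N'%:R * d%:R^-1 :> rat.
    (* Factoring out the expected rank turns the comparison of the two contracts into that of
       [2 * N] with [T]. *)
    have cq : (1 - c) * (exp_rank M l + prob_unspanned M a l)
        = exp_rank M l * ((2 * (r + N))%:R / (2 * r + T)%:R).
      rewrite er eN /c natrM (natrD _ r N) erT; field.
      by rewrite -erT !gt_eqF.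
    have := ans; rewrite cq -/es -/x ger_pMr // ler_pMr // ler_pdivrMr // ler_pdivlMr //.
    rewrite !mul1r !ler_nat => -[[-> h]|[-> h]].
      exists lo; rewrite !mul0r addr0; split=> //.
      by move: h; rewrite /T; lia.
    exists (lo + 2 ^ k)%N; rewrite divff ?gt_eqF // mul1r -mulrDl -natrD; split=> //.
    by move: h; rewrite /T; lia.
  apply: wp_assign; rewrite /= /upd /= e10 /= hx.
    by move=> _; apply: frac_size => //; apply: dm; lia.
  exists k => //; split; first by do 5 (apply: agree_off_upd => //).
  by split; [exact: ltnW | exists N'].
- move=> k s1 [fr [kK [lo [e10 e11 /andP[loN Nlo]]]]].
  have e4 : s1 4 = Atom d%:R^-1 by rewrite fr.
  rewrite /= e11 e4 /= -{2}[d%:R^-1]mul1r -mulrBl negbK mulf_eq0 invr_eq0.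
  rewrite [d%:R == 0]gt_eqF // orbF subr_eq0 pnatr_eq1 => /eqP k1.
  by split=> //; rewrite e10 eN; congr (Atom (_%:R * _)); lia.
Qed.

Lemma tail_size (s : seq 'I_n) : (size s <= n)%N ->
  (data_size (data_list [seq Atom (p i) | i <- s]) <= reg_bound)%N.
Proof.
move=> sn; apply: leq_trans (probs_size s) _.
have : (size s * (sigma + 5) <= sigma * (10 * sigma + 101))%N.
  by apply: leq_mul; [exact: leq_trans n_le | lia].
by rewrite /reg_bound mulSn; lia.
Qed.

Lemma index_size (k : nat) : (k <= n)%N -> (rat_size k%:R <= reg_bound)%N.
Proof.
move=> kn; apply: leq_trans (nat_size (leq_trans kn n_le)) _.
by rewrite /reg_bound mulSn; lia.
Qed.

Lemma free_copies_rcons q s i :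
  free_copies q (rcons s i) = (i, q i) :: free_copies q s.
Proof. by rewrite /free_copies rev_rcons. Qed.

Lemma size_free_copies q s : size (free_copies q s) = size s.
Proof. by rewrite size_map size_rev. Qed.

Lemma mem_free_copies q s x : x \in free_copies q s -> x.2 = q x.1.
Proof. by move=> /mapP[i _ ->]. Qed.

Definition program_input (e : 'I_n) : data :=
  Pair (enc_elt e) (data_list [seq Atom (p i) | i <- enum 'I_n]).

Lemma wp_prepare s e : s 0 = program_input e ->
  wp prepare_com s (fun s' => [/\ s' 0 = s 0,
    s' 3 = enc_free (free_copies (fun=> 0) (enum 'I_n)), s' 4 = Atom d%:R^-1
    & exists2 K, (d < 2 ^ K <= 2 * d)%N & s' 8 = Atom ((2 ^ K)%:R * d%:R^-1)]).
Proof.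
move=> s0.
have sz4 : (4 <= reg_bound)%N by apply: leq_trans reg_bound_num; lia.
have sz6 : (6 <= reg_bound)%N by apply: leq_trans reg_bound_num; rewrite /num_bits; lia.
have szE : size (enum 'I_n) = n := size_enum_ord n.
have d0 : (0 < d)%N := common_denom_gt0 _.
have d0r : 0 < d%:R :> rat by rewrite ltr0n.
apply: wp_seq; apply: wp_assign; rewrite /= s0 /=.
  by move=> _; apply: tail_size; rewrite szE.
apply: wp_seq; apply: wp_assign; first by rewrite /= rat_size0.
apply: wp_seq; apply: wp_assign; first by rewrite /= rat_size0.
apply: wp_seq; apply: wp_assign.
  by move=> _; apply: leq_trans sz6; exact: (rat_size_bool true).
pose J k s' := s' 0%N = s 0%N /\ exists t1 t2 : seq 'I_n,
  [/\ enum 'I_n = t1 ++ t2, size t2 = k,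
      s' 1%N = data_list [seq Atom (p i) | i <- t2]
    & [/\ s' 2 = Atom (size t1)%:R, s' 3 = enc_free (free_copies (fun=> 0) t1)
        & s' 4 = Atom (common_denom t1)%:R^-1]].
apply: wp_seq; apply: (@wp_while _ _ _ _ _ _ _ _ J n).
- split; first by rewrite /upd /=.
  exists [::], (enum 'I_n); rewrite /upd /= szE; split=> //; split=> //.
  by rewrite /common_denom big_nil invr1.
- by apply: leq_trans n_le _; rewrite /iter_bound /num_bits mulSn; lia.
- move=> k s1 [e0 [t1 [t2 [et k2 e1 [e2 e3 e4]]]]].
  rewrite /= e1; case: t2 et k2 e1 => [|i t2] //= et k2 e1 _.
  have it1 := enum_ord_split et.
  have sz1 : (size t1 < n)%N by rewrite -it1.
  have sz2 : (size t2 <= n)%N by have := congr1 size et; rewrite szE size_cat /=; lia.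
  have et' : enum 'I_n = rcons t1 i ++ t2 by rewrite cat_rcons.
  have ev : eval s1 (ECons (entry_expr (EVar 2) (EConst 0) (EConst 0)) (EVar 3))
      = enc_free (free_copies (fun=> 0) (rcons t1 i)).
    by rewrite free_copies_rcons /= e2 e3 -it1.
  have dd : (common_denom (rcons t1 i) <= d)%N.
    by rewrite et' common_denom_cat leq_pmulr // common_denom_gt0.
  have dr : common_denom (rcons t1 i) = (common_denom t1 * `|denq (p i)|)%N.
    by rewrite -cats1 common_denom_cat /common_denom big_seq1.
  have c0 := common_denom_gt0 t1.
  have c0r := common_denom_gt0 (rcons t1 i).
  (* Over the next common denominator, the numerator of the operand is at most [d], which bounds its
     size. *)
  have epD : p i * (common_denom t1)%:R^-1
      = `|numq (p i)|%:R * (common_denom (rcons t1 i))%:R^-1.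
    have pE : p i * `|denq (p i)|%:R = `|numq (p i)|%:R.
      rewrite pmulrn [X in X%:~R]absz_denq -numqE pmulrn gez0_abs //.
      by rewrite numq_ge0; case/andP: (p01 i).
    have b0 : `|denq (p i)|%:R != 0 :> rat by rewrite pnatr_eq0 absz_eq0 denq_neq0.
    by rewrite dr natrM invfM -pE [_^-1 * _]mulrC mulrA mulfK.
  have np : (`|numq (p i)| <= d)%N.
    apply: leq_trans (_ : `|denq (p i)| <= _)%N.
      rewrite -lez_nat !gez0_abs ?numq_ge0 ?denq_ge0 //; last by case/andP: (p01 i).
      rewrite -(ler_int rat) numqE ger_pMl ?ltr0z ?denq_gt0 //.
      by case/andP: (p01 i).
    by apply: leq_trans dd; rewrite dr leq_pmull.
  have szp : (data_size (Atom (p i * (common_denom t1)%:R^-1)) <= reg_bound)%N.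
    by rewrite epD; apply: frac_size => //; apply: num_lt; lia.
  have Db : (common_denom t1 * `|denq (p i)| < 2 ^ num_bits.+1)%N.
    by rewrite -dr; apply: num_lt; lia.
  have hgcd s' e4' e5' e6' :=
    @wp_gcd _ M O _ _ _ good_query (leqnn _) reg_bound_num s' _ _ (p01 i) c0 Db e4' e5' e6'.
  apply: wp_seq; apply: wp_assign; rewrite ev.
    move=> _; apply: enc_free_size; first by rewrite size_free_copies size_rcons; lia.
    by move=> x /mem_free_copies ->; rewrite rat_size0; lia.
  apply: wp_seq; apply: wp_assign; rewrite /= /upd /= e1 e4 /= //.
  apply: wp_seq; apply: wp_assign => //=.
  apply: wp_seq; apply: (wp_conseq _ (hgcd _ _ _ _)); last 3 first.
  + by rewrite /upd /= ?e4.
  + by rewrite /upd /= ?e4.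
  + by rewrite /upd /= ?e4.
  move=> s2 [fr e4']; rewrite -dr in e4'.
  apply: wp_seq; apply: wp_assign; rewrite /= fr //= /upd /= e1 /=.
    by move=> _; apply: tail_size.
  apply: wp_assign; rewrite /= /upd /= fr //= /upd /= e2 /= natr1.
    by move=> _; apply: index_size.
  exists (size t2); first by rewrite -k2.
  split; first by rewrite /= fr.
  exists (rcons t1 i), t2; split=> //; rewrite /= size_rcons; split=> //.
  by rewrite fr.
move=> k s1 [e0 [t1 [t2 [et k2 e1 [e2 e3 e4]]]]].
rewrite /= e1; case: t2 et k2 e1 => [|i t2] //= et k2 e1 _.
rewrite cats0 in et; rewrite -{t1}et in e2 e3 e4.
apply: wp_seq; apply: wp_assign; rewrite /= e4.
  by move=> _; rewrite -[X in Atom X]mul1r; apply: (@frac_size 1) => //; apply: num_lt; lia.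
(* Doubling takes place only while [2 ^ j <= d <= 2 ^ sigma], so [j] is at most [sigma.+1] and [k]
   stays positive. *)
pose J2 k s' := agree_off [:: 8] s1 s' /\ exists j,
  [/\ s' 8 = Atom ((2 ^ j)%:R * d%:R^-1), (2 ^ j <= 2 * d)%N & (j + k = sigma.+2)%N].
apply: (@wp_while _ _ _ _ _ _ _ _ J2 sigma.+2).
- split; first exact: agree_off_upd.
  by exists 0%N; rewrite /upd /= expn0 mul1r; split=> //; lia.
- by rewrite /iter_bound mulSn /num_bits; lia.
- move=> k' s2 [fr [j [e8 jd jk]]]; rewrite /= e8 /= natr_bool_neq0.
  rewrite ler_pdivrMr // mul1r ler_nat => jd'.
  have js : (j <= sigma)%N by rewrite -(@leq_exp2l 2) // (leq_trans jd').
  have e2j : (2 ^ j)%:R / d%:R + (2 ^ j)%:R / d%:R = (2 ^ j.+1)%:R / d%:R :> rat.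
    by rewrite -mulrDl -natrD addnn -mul2n expnS.
  have j2 : (2 ^ j.+1 <= 2 * d)%N by rewrite expnS leq_mul2l.
  apply: wp_assign; rewrite /= e8 /= e2j.
    by move=> _; apply: frac_size => //; apply: num_lt; lia.
  exists k'.-1; first by lia.
  split; first exact: agree_off_upd.
  by exists j.+1; rewrite /upd /=; split=> //; lia.
move=> k' s2 [fr [j [e8 jd jk]]]; rewrite /= e8 /= natr_bool_neq0.
rewrite ler_pdivrMr // mul1r ler_nat -ltnNge => jd'.
split.
- by rewrite (fr 0%N) // e0 ?s0.
- by rewrite (fr 3).
- by rewrite (fr 4).
- by exists j; rewrite // jd' jd.
Qed.

(** * The main loop over the elements *)

Definition query_copies (s : seq 'I_n) : seq ('I_n * rat) :=
  free_copies p s ++ free_copies (fun=> 0) (enum 'I_n).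

Lemma query_copies_rcons s i :
  query_copies (rcons s i) = (i, p i) :: query_copies s.
Proof. by rewrite /query_copies free_copies_rcons. Qed.

Lemma query_copies_probs s : probs (query_copies s).
Proof.
by move=> x; rewrite mem_cat => /orP[] /mem_free_copies ->.
Qed.

Lemma query_copies_mem s i : i \in map fst (query_copies s).
Proof.
apply/mapP; exists (i, 0) => //; rewrite mem_cat; apply/orP; right.
by apply/mapP; exists i; rewrite // mem_rev mem_enum.
Qed.

Lemma query_copies_size s : size (query_copies s) = (size s + n)%N.
Proof. by rewrite size_cat !size_free_copies size_enum_ord. Qed.

Lemma query_copies_rat_size s x : x \in query_copies s -> (rat_size x.2 <= sigma + 4)%N.
Proof.
rewrite mem_cat => /orP[] /mem_free_copies -> //.
by rewrite rat_size0; lia.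
Qed.

(** The denominators of the elements in [s1] multiply to a divisor of [d], so the single denominator
    [d] serves at every stage. *)
Lemma Ex_query_copies s1 s2 (g : {set 'I_n} -> nat) : enum 'I_n = s1 ++ s2 ->
  exists N : nat, Ex (query_copies s1) (fun A => (g A)%:R) = N%:R * d%:R^-1.
Proof.
move=> es; have hl := @query_copies_probs s1.
have d0 : 0 < d%:R :> rat by rewrite ltr0n common_denom_gt0.
have := @Ex_int _ (query_copies s1) (fun A => (g A)%:R) (fun A => natr_int _ (g A)).
have -> : \prod_(x <- query_copies s1) (denq x.2)%:~R = (common_denom s1)%:R :> rat.
  rewrite /query_copies big_cat /= [X in _ * X]big1_seq ?mulr1; last first.
    by move=> x /andP[_ /mem_free_copies ->].
  rewrite big_map (perm_big s1) /=; last by rewrite perm_rev.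
  rewrite /common_denom natr_prod; apply: eq_bigr => i _.
  by rewrite [RHS]pmulrn absz_denq.
set x := Ex _ _ => hx.
have : d%:R * x \is a Num.nat.
  rewrite natrEint es common_denom_cat natrM mulrAC rpredM ?natr_int //=.
  by rewrite !mulr_ge0 // Ex_ge0.
move=> /natrP[N hN]; exists N.
by rewrite -hN mulrAC divff ?mul1r // gt_eqF.
Qed.

Lemma wp_solve_copies s s1 s2 a K : enum 'I_n = s1 ++ s2 ->
  s 3 = enc_free (query_copies s1) -> s 4 = Atom d%:R^-1 ->
  s 8 = Atom ((2 ^ K)%:R * d%:R^-1) -> (d < 2 ^ K <= 2 * d)%N ->
  s 9 = Atom (exp_rank M (query_copies s1)) -> s 15 = enc_elt a ->
  wp solve_com s (fun s' => agree_off [:: 10; 11; 12; 13; 14] s s' /\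
    s' 10 = Atom (prob_unspanned M a (query_copies s1))).
Proof.
move=> es e3 e4 e8 dK e9 e15.
have [r er] := Ex_query_copies (rank M) es.
have [N eN] := Ex_query_copies (fun A => unspanned M a A) es.
apply: (wp_solve _ _ er _ eN e3 e4 e8 dK e9 e15).
- exact: query_copies_probs.
- exact: query_copies_mem.
(* The expected rank is at most the number of copies, of which there are at most [2 * n]. *)
have := exp_rank_le M (@query_copies_probs s1).
have d0 : 0 < d%:R :> rat by rewrite ltr0n common_denom_gt0.
rewrite /exp_rank er ler_pdivrMr // -natrM ler_nat query_copies_size => /leq_trans; apply.
rewrite leq_mul2r; apply/orP; right.
have h := congr1 size es; rewrite size_enum_ord size_cat in h.
have := leq_addr (size s2) (size s1); rewrite -h => s1n.
by apply: leq_trans (leq_add s1n (leqnn n)) _; lia.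
Qed.

Lemma wp_upm s e : s 0 = program_input e ->
  wp upm_com s (fun s' => s' 0 = Atom (prob_unspanned M e (query_copies (enum 'I_n)))).
Proof.
move=> s0.
have szE : size (enum 'I_n) = n := size_enum_ord n.
have d0r : 0 < d%:R :> rat by rewrite ltr0n common_denom_gt0.
apply: wp_seq; apply: (wp_conseq _ (wp_prepare s0)) => s1 [e0 e3 e4 [K dK e8]].
rewrite s0 in e0.
apply: wp_seq; apply: wp_assign; rewrite /= e0 /=.
  by move=> _; apply: tail_size; rewrite szE.
apply: wp_seq; apply: wp_assign.
  by move=> _; apply: leq_trans reg_bound_num; rewrite /= rat_size0; lia.
apply: wp_seq; apply: wp_assign.
  by move=> _; apply: leq_trans reg_bound_num; rewrite /= rat_size0; lia.
pose J k s' := [/\ s' 0%N = program_input e, s' 4 = Atom d%:R^-1,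
    s' 8 = Atom ((2 ^ K)%:R * d%:R^-1) & exists t1 t2 : seq 'I_n,
  [/\ enum 'I_n = t1 ++ t2, size t2 = k,
      s' 1%N = data_list [seq Atom (p i) | i <- t2]
    & [/\ s' 2 = Atom (size t1)%:R, s' 3 = enc_free (query_copies t1)
        & s' 9 = Atom (exp_rank M (query_copies t1))]]].
apply: wp_seq; apply: (@wp_while _ _ _ _ _ _ _ _ J n).
- rewrite /upd /=; split=> //.
  exists [::], (enum 'I_n); rewrite /= szE; split=> //; split=> //.
  congr (Atom _); apply/esym.
  (* Initially all copies are dummies; dropping them leaves the empty set, of rank 0. *)
  rewrite /exp_rank -(@Ex_filter _ pred0) ?filter_pred0 /= ?rank0 //.
  by move=> x; rewrite mem_cat => /orP[//|] /mem_free_copies.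
- by apply: leq_trans n_le _; rewrite /iter_bound /num_bits mulSn; lia.
- move=> k s2 [f0 f4 f8 [t1 [t2 [et k2 f1 [f2 f3 f9]]]]].
  rewrite /= f1; case: t2 et k2 f1 => [|i t2] //= et k2 f1 _.
  have it1 := enum_ord_split et.
  have sz1 : (size t1 < n)%N by rewrite -it1.
  have sz2 : (size t2 <= n)%N by have := congr1 size et; rewrite szE size_cat /=; lia.
  have et' : enum 'I_n = rcons t1 i ++ t2 by rewrite cat_rcons.
  apply: wp_seq; apply: wp_assign; rewrite /= f2.
    by move=> _; apply: index_size; exact: ltnW.
  have f15 : upd s2 15 (Atom (size t1)%:R) 15 = enc_elt i by rewrite /enc_elt it1.
  apply: wp_seq; apply: (wp_conseq _ (wp_solve_copies et _ _ _ dK _ f15)).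
  2-5: by rewrite /upd /=.
  move=> s3 [fr g10].
  have [N eN] := Ex_query_copies (rank M) et'.
  have eR : exp_rank M (query_copies t1) + p i * prob_unspanned M i (query_copies t1)
      = exp_rank M (query_copies (rcons t1 i)).
    by rewrite query_copies_rcons exp_rank_cons.
  (* Only registers 10 to 14 are changed by [solve_com], and 15 by the assignment before it. *)
  have g r : r \notin [:: 10; 11; 12; 13; 14; 15] -> s3 r = s2 r.
    move=> nr; rewrite fr /upd; first by case: eqP nr => // ->.
    apply: contra nr; rewrite !inE.
    by do 4 (case/orP => [->|]; rewrite ?orbT //); move=> ->; rewrite ?orbT.
  apply: wp_seq; apply: wp_assign; rewrite /= (g 9) // (g 1%N) // f1 f9 g10 /= eR.
    move=> _; rewrite /exp_rank eN; apply: frac_size; last 1 first.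
    + by apply: num_lt; lia.
    + have h := exp_rank_le M (@query_copies_probs (rcons t1 i)); move: h.
      rewrite /exp_rank eN ler_pdivrMr // -natrM ler_nat query_copies_size size_rcons => h.
      apply: num_lt; apply: leq_trans h _.
      apply: leq_trans (_ : 2 * sigma * d <= _)%N; last by lia.
      by rewrite leq_mul2r; apply/orP; right; lia.
    + exact: common_denom_gt0.
  have ev : eval (upd s3 9 (Atom (exp_rank M (query_copies (rcons t1 i)))))
      (ECons (entry_expr (EVar 2) (EConst 0) (EFst (EVar 1))) (EVar 3))
      = enc_free (query_copies (rcons t1 i)).
    by rewrite query_copies_rcons /= /upd /= !g // f2 f1 f3 -it1.
  apply: wp_seq; apply: wp_assign; rewrite ev.
    move=> _; apply: enc_free_size; first by rewrite query_copies_size size_rcons; lia.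
    exact: query_copies_rat_size.
  apply: wp_seq; apply: wp_assign; rewrite /= /upd /= !g // f1 /=.
    by move=> _; apply: tail_size.
  apply: wp_assign; rewrite /= !g // f2 /= natr1.
    by move=> _; apply: index_size.
  exists (size t2); first by rewrite -k2.
  split.
  + by rewrite /upd /= (g 0%N).
  + by rewrite /upd /= (g 4).
  + by rewrite /upd /= (g 8).
  by exists (rcons t1 i), t2; rewrite /upd /= size_rcons.
move=> k s2 [f0 f4 f8 [t1 [t2 [et k2 f1 [f2 f3 f9]]]]].
rewrite /= f1; case: t2 et k2 f1 => [|i t2] //= et k2 f1 _.
have et1 : t1 = enum 'I_n by rewrite et cats0.
rewrite {}et1 in f3 f9 et.
apply: wp_seq; apply: wp_assign; rewrite /= f0 /=.
  by move=> _; apply: index_size; exact: ltnW.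
apply: wp_seq; apply: (wp_conseq _ (wp_solve_copies et (a := e) _ _ _ dK _ _)).
2-6: by rewrite /upd /=.
move=> s3 [fr g10].
by apply: wp_assign; rewrite /= ?g10 // -g10; apply.
Qed.

End Solve.

(** * Specialization to an instance of UPM *)

Section Upm.
Variable U : upm.
Hypothesis validU : upm_valid U.
Local Notation e := (uelt U).
Local Notation sigma := (upm_size U).

Definition upm_prob (i : 'I_(un U)) : rat := if i == e then 0 else uprob U i.

Lemma upm_prob_bounds i : 0 <= upm_prob i <= 1.
Proof. by rewrite /upm_prob; case: eqVneq => // /validU. Qed.

Lemma upm_n_le : (un U <= sigma)%N.
Proof. exact: leq_addr. Qed.

Lemma upm_prob_size i : (rat_size (upm_prob i) <= sigma + 4)%N.
Proof.
rewrite /upm_prob; case: eqVneq => [_|ie]; first by rewrite rat_size0 leq_addl.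
by rewrite /upm_size (bigD1 i) //=; lia.
Qed.

(** Each denominator is below 2 to the power of the bit size of its fraction, and these sizes add
    up; the distinguished element contributes denominator 1. *)
Lemma upm_denom_le : (common_denom upm_prob (enum 'I_(un U)) <= 2 ^ sigma)%N.
Proof.
rewrite /common_denom big_enum /= (bigD1 e) //= {1}/upm_prob eqxx mul1n.
apply: (@leq_trans (2 ^ (\sum_(i | i != e) rat_size (uprob U i)))); last first.
  by rewrite leq_exp2l // leq_addl.
rewrite expn_sum; apply: leq_prod => i /negPf ie; rewrite /upm_prob ie.
apply: ltnW; apply: leq_trans (int_size_spec _) _.
by rewrite leq_exp2l // /rat_size; lia.
Qed.

(** Discarding the entries of probability 0 removes the dummies and then the distinguished element;
    [Ex_sum] expands what remains into the defining sum. *)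
Lemma upm_answerE :
  upm_answer U = prob_unspanned (umat U) e (query_copies upm_prob (enum 'I_(un U))).
Proof.
pose l := free_copies upm_prob (enum 'I_(un U)).
have -> : prob_unspanned (umat U) e (query_copies upm_prob (enum 'I_(un U)))
    = prob_unspanned (umat U) e l.
  rewrite /prob_unspanned -(@Ex_filter _ (fun x => x.2 != 0)); last first.
    by move=> x _; rewrite negbK => /eqP.
  rewrite /query_copies filter_cat.
  rewrite [X in _ ++ X](_ : _ = [::]) ?cats0.
    by rewrite Ex_filter // => x _; rewrite negbK => /eqP.
  apply/eqP; rewrite -[_ == _]negbK -has_filter; apply/hasPn => x.
  by move=> /mem_free_copies ->; rewrite eqxx.
rewrite /prob_unspanned -(@Ex_filter _ (fun x => x.1 != e)); last first.
  by move=> x /mem_free_copies -> ; rewrite negbK /upm_prob => ->.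
pose s := [seq i <- rev (enum 'I_(un U)) | i != e].
have -> : [seq x <- l | x.1 != e] = [seq (i, upm_prob i) | i <- s].
  by rewrite /l /free_copies filter_map.
rewrite -Ex_sum; last by rewrite filter_uniq // rev_uniq enum_uniq.
have -> : [set i in s] = [set~ e].
  by apply/setP => i; rewrite !inE mem_filter mem_rev mem_enum andbT.
rewrite /upm_answer big_mkcondr /=; apply: eq_bigr => T sT.
rewrite /unspanned; case: ifP => _; rewrite ?mulr0 // mulr1.
have neT i : i \in [set~ e] -> upm_prob i = uprob U i.
  by rewrite !inE /upm_prob => /negPf ->.
congr (_ * _); apply: eq_bigr => i; first by move=> /(subsetP sT) /neT.
by rewrite inE => /andP[_ /neT ->].
Qed.

Lemma upm_init_bounded :
  bounded (reg_bound sigma) (init_store (enc_upm U)).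
Proof.
move=> x; rewrite /init_store /upd; case: eqP => _ /=; last first.
  by rewrite rat_size0 /reg_bound mulSn; lia.
have h1 := nat_size (leq_trans (ltnW (ltn_ord e)) upm_n_le).
have h2 := probs_size upm_n_le upm_prob_size upm_denom_le (enum 'I_(un U)).
rewrite size_enum_ord in h2.
have h3 : (un U * (sigma + 5) <= sigma * (10 * sigma + 101))%N.
  by apply: leq_mul; [exact: upm_n_le | lia].
rewrite /reg_bound mulSn.
apply: leq_ltn_trans (leq_add h1 h2) _; lia.
Qed.

End Upm.

Theorem theorem3 :
  exists (prog : com) (b : {poly nat}),
  forall (R : realType) (O : olcpm -> rat), solves_olcpm R O ->
  forall U : upm, upm_valid U ->
  exists (s : store) (t : nat) (queries : seq olcpm),
    [/\ exec (umat U) O prog (init_store (enc_upm U)) s t queries,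
        s 0%N = Atom (upm_answer U),
        (t <= b.[upm_size U])%N,
        (size queries <= b.[upm_size U])%N
      & List.Forall (fun I : olcpm =>
          [/\ olcpm_valid I,
              is_parallel_extension (umat U) (omat I)
            & (olcpm_size I <= b.[upm_size U])%N]) queries].
Proof.
have pB : poly_bounded reg_bound.
  apply: poly_boundedM.
    apply: poly_boundedS.
    by apply: poly_boundedM; [exact: poly_bounded_const | exact: poly_bounded_id].
  apply: poly_boundedD; last exact: poly_bounded_const.
  by apply: poly_boundedM; [exact: poly_bounded_const | exact: poly_bounded_id].
have pN : poly_bounded num_bits.
  apply: poly_boundedD; last exact: poly_bounded_const.
  by apply: poly_boundedM; [exact: poly_bounded_const | exact: poly_bounded_id].
have pI : poly_bounded iter_bound.
  have [c hc] := poly_boundedD (poly_boundedM (poly_boundedS pN)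
    (poly_boundedD (poly_boundedD pN pN) (poly_bounded_const 3))) (poly_boundedS pN).
  by exists c => x; apply: leq_trans (hc x); rewrite /iter_bound -addnn; lia.
have [bt ht] := poly_bounded_com upm_com pI pB.
have [bq hq] := poly_boundedM (poly_bounded_const (expr_factor query_expr)) (poly_boundedS pB).
(* [bt] bounds the running time, hence the number of queries, and [bq] the size of each query. *)
exists upm_com, (bt + bq) => R O solO U validU.
have [|s [t [q [ex tb gq _ ans]]]] := wp_upm (umat U) solO (upm_n_le U)
  (upm_prob_bounds validU) (@upm_prob_size U) (@upm_denom_le U)
  (s := init_store (enc_upm U)) (e := uelt U)
  _ (upm_init_bounded U); first by [].
have tb' : (t <= (bt + bq).[upm_size U])%N.
  by rewrite hornerD; apply: leq_trans tb _; apply: leq_trans (ht _) (leq_addr _ _).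
exists s, t, q; split=> //.
- by rewrite ans upm_answerE.
- exact: leq_trans (exec_queries_le ex) tb'.
apply: List.Forall_impl gq => I [h1 h2 h3]; split=> //.
by rewrite hornerD; apply: leq_trans h3 _; apply: leq_trans (hq _) (leq_addl _ _).
Qed.
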